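(* Let $X$ be a compact metrizable space with more than one point. Then $HX$ is homeomorphic to the Hilbert cube $Q$.
   Context: For a compact Hausdorff space $X$, let $\mathrm{HM}X$ be the set of all maps $\alpha:[0,1)\to X$ for which there exist $0=t_0\le t_1\le\cdots\le t_n=1$ such that $\alpha$ is constant on each $[t_i,t_{i+1})$. Let $C(X)$ be the set of continuous functions $X\to\mathbb{R}$. For $\varphi\in C(X)$ and $0\le a<b\le 1$ define $\varphi_{(a,b)}:\mathrm{HM}X\to\mathbb{R}$ by $\varphi_{(a,b)}(\alpha)=\frac{1}{b-a}\int_a^b\varphi(\alpha(t))\,dt$. Let $S_{\mathrm{HM}}(X)$ be the set of all such functions $\varphi_{(a,b)}$. The uniformity $\mathcal{U}_{\mathrm{HM}X}$ on $\mathrm{HM}X$ is the one generated by the pseudometrics $\rho_{\psi_1,\dots,\psi_n}(f,g)=\max_{1\le i\le n}|\psi_i(f)-\psi_i(g)|$, where $n\in\mathbb{N}$ and $\psi_1,\dots,\psi_n\in S_{\mathrm{HM}}(X)$; it is totally bounded. The uniform space $(HX,\mathcal{U}_{HX})$ is the (Hausdorff) completion of $(\mathrm{HM}X,\mathcal{U}_{\mathrm{HM}X})$, and $HX$ carries the topology induced by $\mathcal{U}_{HX}$; it is a compact Hausdorff space containing $\mathrm{HM}X$ as a dense subset. The Hilbert cube $Q$ is a countably infinite product of nondegenerate closed intervals. *)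

(* Defs.v *)
From HB Require Import structures.
From mathcomp Require Import all_boot all_order all_algebra.
From mathcomp Require Import all_classical all_reals all_analysis.
Import Order.TTheory GRing.Theory Num.Theory.
Import numFieldNormedType.Exports.

Set Implicit Arguments.
Unset Strict Implicit.
Unset Printing Implicit Defensive.

Local Open Scope classical_set_scope.
Local Open Scope ring_scope.

Definition homeomorphic (T U : topologicalType) : Prop :=
  exists (f : T -> U) (g : U -> T),
    [/\ cancel f g, cancel g f, continuous f & continuous g].

Definition metrizable (R : realType) (X : topologicalType) : Prop :=
  exists d : X -> X -> R,
    [/\ forall x y, d x y = 0 <-> x = y,
        forall x y, d x y = d y x,
        forall x y z, d x z <= d x y + d y z &
        forall x, nbhs x =
          filter_from [set e : R | 0 < e] (fun e => [set y | d x y < e])].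

(* Hausdorff completion of a uniform space (Bourbaki's construction): points
   are the minimal Cauchy filters, and two of them are V-close when they share
   a V-small set. *)
Section completion.
Local Open Scope relation_scope.
Variable U : uniformType.

Record completion : Type := Completion {
  cfilter : set_system U;
  cfilter_proper : ProperFilter cfilter;
  cfilter_cauchy : cauchy cfilter;
  cfilter_min : forall G : set_system U, ProperFilter G -> cauchy G ->
    G `<=` cfilter -> cfilter `<=` G }.

HB.instance Definition _ := gen_eqMixin completion.
HB.instance Definition _ := gen_choiceMixin completion.

Definition completion_close (V : set (U * U)) : set (completion * completion) :=
  [set FG : completion * completion |
    exists2 A, cfilter FG.1 A /\ cfilter FG.2 A & A `*` A `<=` V].

Definition completion_ent : set_system (completion * completion) :=
  filter_from entourage completion_close.

Lemma cauchy_small (F : set_system U) (V : set (U * U)) :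
  Filter F -> cauchy F -> entourage V -> exists2 A, F A & A `*` A `<=` V.
Proof.
move=> FF cF /cF[[P Q]/= [FP FQ] PQV]; exists (P `&` Q); first exact: filterI.
by move=> [x y]/= [[Px _] [_ Qy]]; exact: PQV.
Qed.

Lemma small_cauchy (F : set_system U) :
  (forall V, entourage V -> exists2 A, F A & A `*` A `<=` V) -> cauchy F.
Proof. by move=> h V /h[A FA AV]; exists (A, A). Qed.

Lemma completion_eq (F G : completion) : cfilter F = cfilter G -> F = G.
Proof.
case: F G => [F ? ? ?] [G ? ? ?]/= FG; subst G.
by congr Completion; exact: Prop_irrelevance.
Qed.

Let completion_ent_filter : Filter completion_ent.
Proof.
apply: filter_from_filter; first by exists setT; exact: entourageT.
move=> V W eV eW; exists (V `&` W); first exact: filterI.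
by move=> [F G] [A FGA AVW]; split; exists A => // xy /AVW[].
Qed.

Let completion_ent_diagonal E : completion_ent E -> diagonal `<=` E.
Proof.
move=> [V eV VE] [F G]/diagonalP <-; apply: VE.
have [A FA AV] := cauchy_small (cfilter_proper F) (@cfilter_cauchy F) eV.
by exists A.
Qed.

Let completion_ent_inv E : completion_ent E -> completion_ent E^-1.
Proof.
move=> [V eV VE]; exists V => // -[F G] [A [FA GA] AV].
by apply: VE; exists A.
Qed.

Let completion_ent_split E : completion_ent E ->
  exists2 D, completion_ent D & D \; D `<=` E.
Proof.
move=> [V eV VE]; exists (completion_close (split_ent V)).
  by exists (split_ent V) => //; exact: entourage_split_ent.
move=> [F H] [G [A [FA GA] AV] [B [GB HB] BV]]; apply: VE.
have [z [Az Bz]] := @filter_ex _ _ (cfilter_proper G) _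
  (@filterI _ _ (cfilter_proper G) _ _ GA GB).
exists (A `|` B).
  split; first exact: (@filterS _ _ (cfilter_proper F) _ _ (@subsetUl _ A B)).
  exact: (@filterS _ _ (cfilter_proper H) _ _ (@subsetUr _ A B)).
have small (C : set U) x y : C `*` C `<=` split_ent V -> C x -> C y ->
  split_ent V (x, y) by move=> CV Cx Cy; exact: CV.
move=> [x y] [/= ABx ABy]; apply: (entourage_split z) => //.
  by case: ABx => ?; [apply: (small A)|apply: (small B)].
by case: ABy => ?; [apply: (small A)|apply: (small B)].
Qed.

HB.instance Definition _ := isUniform.Build completion completion_ent_filter
  completion_ent_diagonal completion_ent_inv completion_ent_split.

End completion.

Section completion_theory.
Local Open Scope relation_scope.
Variable U : uniformType.
Implicit Types (V W : set (U * U)) (F G : completion U).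

Lemma nbhs_cauchy (x : U) : cauchy (nbhs x).
Proof.
apply: small_cauchy => V eV.
pose W := split_ent V `&` (split_ent V)^-1.
have eW : entourage W by apply: filterI => //; exact: entourage_inv.
exists (xsection W x); first exact: nbhs_entourage.
move=> [y z]/= [/xsectionP[_ yx] /xsectionP[xz _]].
exact: (entourage_split x).
Qed.

Lemma nbhs_cauchy_min (x : U) (G : set_system U) : ProperFilter G ->
  cauchy G -> G `<=` nbhs x -> nbhs x `<=` G.
Proof.
move=> PG cG Gx B /nbhsP[V eV VB].
have [A GA AV] := cauchy_small PG cG eV.
have Ax : A x by exact: nbhs_singleton (Gx _ GA).
by apply: filterS GA => y Ay; apply: VB; apply/xsectionP; exact: AV.
Qed.

Definition to_completion (x : U) : completion U :=
  Completion (nbhs_pfilter x) (@nbhs_cauchy x) (@nbhs_cauchy_min x).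

Lemma completion_entourageP E : @entourage (completion U) E <->
  exists2 V, entourage V & completion_close V `<=` E.
Proof. by []. Qed.

Lemma to_completion_entourage V : entourage V <->
  exists2 E, @entourage (completion U) E &
    [set xy | E (to_completion xy.1, to_completion xy.2)] `<=` V.
Proof.
split=> [eV|[E [W eW WE] EV]].
  exists (completion_close V); first by exists V.
  move=> [x y]/= [A /= [xA yA] AV]; apply: AV.
  by split; exact: nbhs_singleton.
apply: filterS EV _ => /=.
have [A eA AW] := entourage_split_ex eW.
pose S := A `&` A^-1.
have eS : entourage S by apply: filterI => //; exact: entourage_inv.
have eT := entourage_split_ent eS; set T := split_ent S in eT.
apply: filterS eT => -[x y]/= Txy; apply: WE.
exists (xsection S x); first split => /=.
- exact: nbhs_entourage.
- apply/nbhsP; exists T; first exact: entourage_split_ent.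
  move=> z /xsectionP yz; apply/xsectionP.
  exact: (entourage_split y).
- move=> [a b]/= [/xsectionP[_ xa] /xsectionP[xb _]].
  by apply: AW; exists x.
Qed.

Definition thicken W (A : set U) : set U :=
  [set y | exists2 x, A x & W (x, y)].

Lemma thicken_self W A : entourage W -> A `<=` thicken W A.
Proof. by move=> eW x Ax; exists x => //; exact: entourage_refl. Qed.

Lemma thicken_small V : entourage V -> exists2 S, entourage S &
  forall A, A `*` A `<=` S -> thicken S A `*` thicken S A `<=` V.
Proof.
move=> eV; set T := split_ent (split_ent V).
have eT : entourage T by do 2 apply: entourage_split_ent.
exists (T `&` T^-1); first exact: entourage_invI.
move=> A AT [y z]/= [[a Aa [_ ya]] [b Ab [bz _]]].
have [ab _] : (T `&` T^-1) (a, b) by exact: AT.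
apply: (entourage_split b) => //; first exact: (entourage_split a).
by apply: split_ent_subset => //; exact: entourage_split_ent.
Qed.

Lemma to_completion_dense : dense (range to_completion).
Proof.
move=> O [F OF] oO.
have : nbhs F O by exact: open_nbhs_nbhs.
rewrite -nbhs_entourageE => -[E [V eV VE] EO].
have [S eS SV] := thicken_small eV.
have [A FA AS] := cauchy_small (cfilter_proper F) (@cfilter_cauchy _ F) eS.
have [x Ax] := @filter_ex _ _ (cfilter_proper F) _ FA.
exists (to_completion x); split; last by exists x.
apply/EO/xsectionP/VE; exists (thicken S A); last exact: SV.
split => /=.
  exact: (@filterS _ _ (cfilter_proper F) _ _ (thicken_self eS)).
apply/nbhsP; exists S => // y /xsectionP xy.
by exists x.
Qed.

Lemma completion_separated F G :
  (forall E, @entourage (completion U) E -> E (F, G)) -> F = G.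
Proof.
move=> FG.
pose H : set_system U := cfilter F `&` cfilter G.
have PF := cfilter_proper F; have PG := cfilter_proper G.
have PH : ProperFilter H.
  split; first by case=> /(@filter_not_empty _ _ PF).
  split; first by split; exact: filterT.
  - by move=> P Q [? ?] [? ?]; split; exact: filterI.
  - by move=> P Q PQ [? ?]; split; exact: filterS PQ _.
have cH : cauchy H.
  apply: small_cauchy => V eV.
  by have [|A ? ?] := FG (completion_close V); [exists V|exists A].
apply: completion_eq; apply/seteqP; split => A.
- by move=> /(@cfilter_min _ F H PH cH (@subIsetl _ _ _))[].
- by move=> /(@cfilter_min _ G H PH cH (@subIsetr _ _ _))[].
Qed.

Lemma completion_hausdorff : hausdorff_space (completion U).
Proof.
move=> F G cFG; apply: completion_separated => E eE.
have eS := entourage_invI (entourage_split_ent eE).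
have [H [/xsectionP[FH _] /xsectionP[_ HG]]] :=
  cFG _ _ (nbhs_entourage F eS) (nbhs_entourage G eS).
exact: (entourage_split H).
Qed.

Definition round (G : set_system U) : set_system U :=
  [set B | exists2 WA, entourage WA.1 /\ G WA.2 & thicken WA.1 WA.2 `<=` B].

Lemma round_sub (G : set_system U) : Filter G -> round G `<=` G.
Proof.
move=> FG B [[W A]/= [eW GA] WAB]; apply: filterS GA.
exact: subset_trans (thicken_self eW) WAB.
Qed.

Lemma round_proper (G : set_system U) : ProperFilter G -> ProperFilter (round G).
Proof.
move=> PG; split.
  by move=> /round_sub; exact: filter_not_empty.
split.
- by exists (setT, setT) => //=; split; [exact: entourageT|exact: filterT].
- move=> P Q [[W A]/= [eW GA] WAP] [[W' A']/= [eW' GA'] WAQ].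
  exists (W `&` W', A `&` A') => /=; first by split; exact: filterI.
  by move=> y [x [Ax A'x] [Wxy W'xy]]; split; [apply: WAP|apply: WAQ]; exists x.
- by move=> P Q PQ [WA h WAP]; exists WA => //; exact: subset_trans PQ.
Qed.

Lemma round_cauchy (G : set_system U) : Filter G -> cauchy G -> cauchy (round G).
Proof.
move=> FG cG; apply: small_cauchy => V eV.
have [S eS SV] := thicken_small eV.
have [A GA AS] := cauchy_small FG cG eS.
by exists (thicken S A); [exists (S, A)|exact: SV].
Qed.

Lemma round_min (G H : set_system U) : ProperFilter G -> ProperFilter H ->
  cauchy H -> H `<=` round G -> round G `<=` H.
Proof.
move=> PG PH cH HG B [[W A]/= [eW GA] WAB].
have [C HC CW] := cauchy_small PH cH eW.
have [z [Cz Az]] := @filter_ex _ _ PG _ (filterI (round_sub _ (HG _ HC)) GA).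
by apply: filterS HC => y Cy; apply: WAB; exists z => //; exact: CW.
Qed.

Lemma completion_complete (Phi : set_system (completion U)) :
  ProperFilter Phi -> cauchy Phi -> exists F, Phi --> F.
Proof.
move=> PPhi cPhi.
pose G : set_system U := [set B | Phi [set F | cfilter F B]].
have PG : ProperFilter G.
  split.
    move=> h; have [F F0] := @filter_ex _ _ PPhi _ h.
    exact: (@filter_not_empty _ _ (cfilter_proper F) F0).
  split.
  - apply: (@filterS _ Phi _ setT) filterT => F _.
    exact: (@filterT _ _ (cfilter_proper F)).
  - move=> P Q GP GQ; apply: (@filterS _ Phi) (@filterI _ Phi _ _ _ GP GQ) => F [? ?].
    exact: (@filterI _ _ (cfilter_proper F)).
  - move=> P Q PQ; apply: (@filterS _ Phi) => F.
    exact: (@filterS _ _ (cfilter_proper F) _ _ PQ).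
have key V : entourage V -> exists A M,
    [/\ A `*` A `<=` V, Phi M & forall F, M F -> cfilter F A].
  move=> eV; have [S eS SV] := thicken_small eV.
  have eE : @entourage (completion U) (completion_close S) by exists S.
  have [[M N]/= [PhiM PhiN] MN] := cPhi _ eE.
  have [F0 [MF0 _]] := filter_ex (filterI PhiM PhiN).
  have [A F0A AS] :=
    cauchy_small (cfilter_proper F0) (@cfilter_cauchy _ F0) eS.
  exists (thicken S A), N; split => //; first exact: SV.
  move=> F NF; have [C [/= F0C FC] CS] := MN (F0, F) (conj MF0 NF).
  have [z [Az Cz]] := @filter_ex _ _ (cfilter_proper F0) _
    (@filterI _ _ (cfilter_proper F0) _ _ F0A F0C).
  apply: (@filterS _ _ (cfilter_proper F)) FC => y Cy.
  by exists z => //; exact: CS.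
have cG : cauchy G.
  apply: small_cauchy => V /key[A [M [AV PhiM MA]]].
  by exists A => //; exact: filterS PhiM.
exists (Completion (round_proper PG) (round_cauchy _ cG)
  (fun H PH => round_min PG PH)).
move=> B /=; rewrite -nbhs_entourageE => -[E [V eV VE] EB].
have [S eS SV] := thicken_small eV.
have [A [M [AS PhiM MA]]] := key _ eS.
have GA : G A by exact: filterS PhiM.
apply: filterS PhiM => F MF; apply/EB/xsectionP/VE.
exists (thicken S A); last exact: SV.
split => /=.
  by exists (S, A).
exact: (@filterS _ _ (cfilter_proper F) _ _ (thicken_self eS) (MA _ MF)).
Qed.

End completion_theory.

Definition Ico01 (R : realType) : set R := `[0, 1[.
Arguments Ico01 : clear implicits.

Section HM.
Variables (R : realType) (X : topologicalType).

Definition step_function (alpha : Ico01 R -> X) : Prop :=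
  exists (n : nat) (t : nat -> R),
    [/\ t 0%N = 0, t n = 1,
        forall i, (i < n)%N -> t i <= t i.+1 &
        forall i, (i < n)%N -> forall x y : Ico01 R,
          t i <= set_val x < t i.+1 -> t i <= set_val y < t i.+1 ->
          alpha x = alpha y].

Record HM : Type := HMap {
  hm_fun :> Ico01 R -> X;
  hm_step : step_function hm_fun }.

HB.instance Definition _ := gen_eqMixin HM.
HB.instance Definition _ := gen_choiceMixin HM.

(* phi \o alpha is extended by 0 outside [0, 1[; since [a, b[ `<=` [0, 1[,
   the extension does not contribute to the integral. *)
Definition hm_avg (phi : X -> R) (a b : R) (alpha : HM) : R :=
  (b - a)^-1 * \int[lebesgue_measure]_(t in `[a, b[) 'valL_ 0 (phi \o alpha) t.

Definition S_HM : set (HM -> R) :=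
  [set psi | exists phi a b,
    [/\ continuous phi, 0 <= a, a < b, b <= 1 & psi = hm_avg phi a b]].

Definition hm_rho (psis : seq (HM -> R)) (f g : HM) : R :=
  \big[Num.max/0]_(psi <- psis) `|psi f - psi g|.

Definition hm_ent : set_system (HM * HM) :=
  filter_from
    [set p : seq (HM -> R) * R | (forall psi, psi \in p.1 -> S_HM psi) /\ 0 < p.2]
    (fun p => [set fg | hm_rho p.1 fg.1 fg.2 < p.2]).

Lemma hm_rho_lt psis f g e : 0 < e ->
  (hm_rho psis f g < e) <-> (forall psi, psi \in psis -> `|psi f - psi g| < e).
Proof.
move=> e0; rewrite /hm_rho; elim: psis => [|psi s IH].
  by rewrite big_nil; split.
rewrite big_cons gt_max; split.
  move=> /andP[h /IH hs] chi; rewrite inE => /orP[/eqP->//|]; exact: hs.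
move=> h; apply/andP; split; first by apply: h; rewrite mem_head.
by apply/IH => chi chis; apply: h; rewrite inE chis orbT.
Qed.

Local Open Scope relation_scope.

Let hm_ent_filter : Filter hm_ent.
Proof.
apply: filter_from_filter; first by exists ([::], 1); split => //=.
move=> [s e] [s' e'] /= [hs e0] [hs' e'0].
have m0 : 0 < Num.min e e' by rewrite lt_min e0.
exists (s ++ s', Num.min e e').
  by split => //= psi; rewrite mem_cat => /orP[/hs|/hs'].
move=> [f g]/= /(hm_rho_lt _ _ _ m0) h; split; apply/hm_rho_lt => // psi psis.
- have : `|psi f - psi g| < Num.min e e' by apply: h; rewrite mem_cat psis.
  by rewrite lt_min => /andP[].
- have : `|psi f - psi g| < Num.min e e' by apply: h; rewrite mem_cat psis orbT.
  by rewrite lt_min => /andP[].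
Qed.

Let hm_ent_diagonal E : hm_ent E -> diagonal `<=` E.
Proof.
move=> [[s e]/= [_ e0] sE] [f g]/diagonalP <-; apply: sE => /=.
by apply/hm_rho_lt => // psi _; rewrite subrr normr0.
Qed.

Let hm_ent_inv E : hm_ent E -> hm_ent E^-1.
Proof.
move=> [[s e]/= [hs e0] sE]; exists (s, e) => // -[f g]/= /hm_rho_lt h.
apply: sE => /=; apply/hm_rho_lt => // psi psis; rewrite distrC; exact: h.
Qed.

Let hm_ent_split E : hm_ent E -> exists2 D, hm_ent D & D \; D `<=` E.
Proof.
move=> [[s e]/= [hs e0] sE]; have e20 : 0 < e / 2 by rewrite divr_gt0.
exists [set fg | hm_rho s fg.1 fg.2 < e / 2]; first by exists (s, e / 2).
move=> [f g]/= [h /(hm_rho_lt _ _ _ e20) fh /(hm_rho_lt _ _ _ e20) hg].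
apply: sE => /=; apply/hm_rho_lt => // psi psis.
rewrite (le_lt_trans (ler_distD (psi h) _ _))// [ltRHS]splitr.
by rewrite ltrD ?fh ?hg.
Qed.

HB.instance Definition _ := isUniform.Build HM hm_ent_filter hm_ent_diagonal
  hm_ent_inv hm_ent_split.

End HM.

Definition HX (R : realType) (X : topologicalType) : uniformType :=
  completion (HM R X).

Definition hilbert_cube (R : realType) (l u : nat -> R) : topologicalType :=
  prod_topology (fun n => `[l n, u n]%classic : set R).

(* Main.v *)
Require Import Defs.
From mathcomp Require Import all_boot all_order all_algebra.
From mathcomp Require Import all_classical all_reals all_analysis.
From mathcomp Require Import ring lra zify.
Import Order.TTheory GRing.Theory Num.Theory.
Import numFieldNormedType.Exports.
Set Implicit Arguments.
Unset Strict Implicit.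
Unset Printing Implicit Defensive.
Local Open Scope classical_set_scope.
Local Open Scope ring_scope.

(** HX is the space of probability-valued maps on [0, 1[, and a point of it is
determined by countably many averages.  Choose partitions of unity e_0, ..., e_n
of X, peaked at points x_0, ..., x_n, each of them in the span of the next, with
dense union of the spans; they map probabilities on X to simplices, and passing
from n to n + 1 adds one vertex.  Cut [0, 1[ into [1 - 2^-k, 1 - 2^-(k+1)[ and
bisect each piece repeatedly, adding one vertex after every bisection.  Listing
the averages of the e_i over the cells one at a time, each of them ranges over an
interval whose end points are continuous functions of the preceding averages, and
for every k the first nontrivial one ranges over all of [0, 1].  Step functions
realise any finite part of such data exactly, so HX is homeomorphic to this tower
of intervals.

It remains to identify the tower with the cube.  The intervals may degenerate to
points, but [-w, w] x [-1, 1]^N is homeomorphic to [-1, 1]^N by a map depending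
continuously on w in [0, 1], the degenerate width w = 0 included: rotating the
square lets the short coordinate move along the sequence, doubling its range at
each step.  Every coordinate is absorbed in this way by an infinite set of
coordinates of full width, all of which come later in the recursion, so that the
result can be inverted coordinate by coordinate. *)

(** * Absorbing an interval into a cube *)

Section square_rotation.
Variable R : realType.
Implicit Types p s a b u v w y : R.

(** An interval whose width depends on parameters and vanishes for some of them cannot be
    straightened inside one fixed interval; an infinite product has to make room for it. Therefore
    every constrained coordinate is given infinitely many partners, and [0, 1[ is cut into
    infinitely many pieces because each piece yields one coordinate whose range is [0, 1] whatever
    the others are. The partners must not precede the coordinate that they absorb: undoing the
    absorption requires its width, which is known only once the earlier coordinates are. Since a
    refinement adds a single vertex, one number determines the new masses of all the old vertices,
    and its constraints cut out an interval; a whole simplex prescribed at once would give fibres of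
    varying dimension. The peaks make every point of a simplex attainable: a step function that
    spends the right share of a cell at each peak has exactly the prescribed averages. Hence no
    point of the tower is missed. *)

Definition sup2 a b := Num.max `|a| `|b|.

Lemma sup2_ge0 a b : 0 <= sup2 a b.
Proof. by rewrite le_max normr_ge0. Qed.

Lemma sup2_eq0 a b : sup2 a b = 0 -> a = 0 /\ b = 0.
Proof.
move=> h; have : `|a| <= 0 /\ `|b| <= 0.
  by rewrite -h /sup2 !le_max !lexx orbT.
by rewrite !normr_le0 => -[/eqP -> /eqP ->].
Qed.

Lemma sup2Z c a b : 0 <= c -> sup2 (c * a) (c * b) = c * sup2 a b.
Proof. by move=> c0; rewrite /sup2 !normrM (ger0_norm c0) maxr_pMr. Qed.

Lemma sup2_le1 a b : (sup2 a b <= 1) = (`|a| <= 1) && (`|b| <= 1).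
Proof. by rewrite /sup2 ge_max. Qed.

Definition lin1 p s a b := p * a + s * b.
Definition lin2 p s a b := p * b - s * a.

(* The matrix ((p, s), (-s, p)) corrected radially so as to preserve the
   sup norm; at the origin, 0 / 0 = 0 gives the right value. *)
Definition scal p s a b := sup2 a b / sup2 (lin1 p s a b) (lin2 p s a b).
Definition rot1 p s a b := scal p s a b * lin1 p s a b.
Definition rot2 p s a b := scal p s a b * lin2 p s a b.

Lemma lin_eq0 p s a b : 0 < p ^+ 2 + s ^+ 2 ->
  sup2 (lin1 p s a b) (lin2 p s a b) = 0 -> sup2 a b = 0.
Proof.
move=> ps /sup2_eq0[]; rewrite /lin1 /lin2 => h1 h2.
have ha : (p ^+ 2 + s ^+ 2) * a = 0.
  by transitivity (p * (p * a + s * b) - s * (p * b - s * a)); [ring|rewrite h1 h2; ring].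
have hb : (p ^+ 2 + s ^+ 2) * b = 0.
  by transitivity (s * (p * a + s * b) + p * (p * b - s * a)); [ring|rewrite h1 h2; ring].
move/eqP: ha; rewrite mulf_eq0 (gt_eqF ps)/= => /eqP ->.
move/eqP: hb; rewrite mulf_eq0 (gt_eqF ps)/= => /eqP ->.
by rewrite /sup2 normr0 maxxx.
Qed.

Lemma scal_ge0 p s a b : 0 <= scal p s a b.
Proof. by rewrite divr_ge0 ?sup2_ge0. Qed.

Lemma sup2_rot p s a b : 0 < p ^+ 2 + s ^+ 2 ->
  sup2 (rot1 p s a b) (rot2 p s a b) = sup2 a b.
Proof.
move=> ps; rewrite sup2Z ?scal_ge0// /scal.
have [h|h] := eqVneq (sup2 (lin1 p s a b) (lin2 p s a b)) 0.
  by rewrite (lin_eq0 ps h) h mulr0.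
by rewrite divfK.
Qed.

(** The matrices for [s] and [- s] multiply to [p ^+ 2 + s ^+ 2] times the identity. The radial
    corrections are positive scalars and the sup norm is preserved, so the second correction cancels
    both that factor and the first correction. *)
Lemma rotK p s a b : 0 < p ^+ 2 + s ^+ 2 ->
  rot1 p (- s) (rot1 p s a b) (rot2 p s a b) = a /\
  rot2 p (- s) (rot1 p s a b) (rot2 p s a b) = b.
Proof.
move=> ps.
have [h|h0] := eqVneq (sup2 a b) 0.
  have [-> ->] := sup2_eq0 h.
  by rewrite /rot1 /rot2 /scal /lin1 /lin2 !(mulr0, mul0r, addr0, subr0).
have n0 : sup2 (lin1 p s a b) (lin2 p s a b) != 0.
  by apply: contra h0 => /eqP/(lin_eq0 ps) ->.
have c0 : 0 < scal p s a b.
  by rewrite divr_gt0 ?lt_neqAle ?sup2_ge0 ?andbT 1?eq_sym.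
set c := scal p s a b in c0.
have e1 : lin1 p (- s) (rot1 p s a b) (rot2 p s a b) =
    (c * (p ^+ 2 + s ^+ 2)) * a.
  by rewrite /rot1 /rot2 -/c /lin1 /lin2; ring.
have e2 : lin2 p (- s) (rot1 p s a b) (rot2 p s a b) =
    (c * (p ^+ 2 + s ^+ 2)) * b.
  by rewrite /rot1 /rot2 -/c /lin1 /lin2; ring.
have d0 : 0 < c * (p ^+ 2 + s ^+ 2) by rewrite mulr_gt0.
have sc : scal p (- s) (rot1 p s a b) (rot2 p s a b) = (c * (p ^+ 2 + s ^+ 2))^-1.
  rewrite {1}/scal sup2_rot// e1 e2 sup2Z ?ltW//.
  by rewrite invfM mulrCA divff ?mulr1.
by split; [rewrite {1}/rot1 e1 sc|rewrite {1}/rot2 e2 sc]; rewrite mulKf ?gt_eqF.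
Qed.

Lemma rotVK p s a b : 0 < p ^+ 2 + s ^+ 2 ->
  rot1 p s (rot1 p (- s) a b) (rot2 p (- s) a b) = a /\
  rot2 p s (rot1 p (- s) a b) (rot2 p (- s) a b) = b.
Proof. by move=> ps; have := @rotK p (- s) a b; rewrite opprK sqrrN; apply. Qed.

Lemma rot_id a b : rot1 1 0 a b = a /\ rot2 1 0 a b = b.
Proof.
rewrite /rot1 /rot2 /scal /lin1 /lin2 !mul1r !mul0r addr0 subr0.
have [h|h] := eqVneq (sup2 a b) 0; last by rewrite divff// !mul1r.
by have [-> ->] := sup2_eq0 h; rewrite !mulr0.
Qed.

Lemma rot_quarter a b : rot1 0 1 a b = b /\ rot2 0 1 a b = - a.
Proof.
rewrite /rot1 /rot2 /scal /lin1 /lin2 !mul1r !mul0r add0r sub0r.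
have -> : sup2 b (- a) = sup2 a b by rewrite /sup2 normrN maxC.
have [h|h] := eqVneq (sup2 a b) 0; last by rewrite divff// !mul1r.
by have [-> ->] := sup2_eq0 h; rewrite oppr0 !mulr0.
Qed.

End square_rotation.

Section square_rotation_continuous.
Variables (R : realType) (Z : topologicalType).
Implicit Types p s a b f g : Z -> R.

Lemma continuousD2 f g : continuous f -> continuous g ->
  continuous (fun z => f z + g z).
Proof. by move=> cf cg z; apply: cvgD; [exact: cf|exact: cg]. Qed.

Lemma continuousB2 f g : continuous f -> continuous g ->
  continuous (fun z => f z - g z).
Proof. by move=> cf cg z; apply: cvgB; [exact: cf|exact: cg]. Qed.

Lemma continuousM2 f g : continuous f -> continuous g ->
  continuous (fun z => f z * g z).
Proof. by move=> cf cg z; apply: cvgM; [exact: cf|exact: cg]. Qed.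

Lemma continuous_norm2 f : continuous f -> continuous (fun z => `|f z|).
Proof. by move=> cf z; apply: cvg_norm; exact: cf. Qed.

Lemma continuous_max2 f g : continuous f -> continuous g ->
  continuous (fun z => Num.max (f z) (g z)).
Proof. by move=> cf cg z; apply: continuous_max; [exact: cf|exact: cg]. Qed.

Lemma continuous_min2 f g : continuous f -> continuous g ->
  continuous (fun z => Num.min (f z) (g z)).
Proof. by move=> cf cg z; apply: continuous_min; [exact: cf|exact: cg]. Qed.

Lemma continuousV2 f : (forall z, f z != 0) -> continuous f ->
  continuous (fun z => (f z)^-1).
Proof. by move=> f0 cf z; apply: cvgV; [exact: f0|exact: cf]. Qed.

Lemma continuous_cst2 (c : R) : continuous (fun _ : Z => c).
Proof. by move=> z; exact: cvg_cst. Qed.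

Lemma continuous_sum2 (I : Type) (r : seq I) (P : pred I) (F : I -> Z -> R) :
  (forall i, continuous (F i)) -> continuous (fun z => \sum_(i <- r | P i) F i z).
Proof.
move=> cF; elim: r => [|i r IH].
  by under eq_fun do rewrite big_nil; exact: continuous_cst2.
under eq_fun do rewrite big_cons.
by case: (P i) => //; exact: continuousD2.
Qed.

Lemma continuous_sup2 a b : continuous a -> continuous b ->
  continuous (fun z => sup2 (a z) (b z)).
Proof. by move=> ca cb; apply: continuous_max2; exact: continuous_norm2. Qed.

Section rot.
Variables p s a b : Z -> R.
Hypotheses (cp : continuous p) (cs : continuous s) (ca : continuous a)
  (cb : continuous b) (ps : forall z, 0 < p z ^+ 2 + s z ^+ 2).

Let cl1 : continuous (fun z => lin1 (p z) (s z) (a z) (b z)).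
Proof. by apply: continuousD2; exact: continuousM2. Qed.

Let cl2 : continuous (fun z => lin2 (p z) (s z) (a z) (b z)).
Proof. by apply: continuousB2; exact: continuousM2. Qed.

(* Off the zeros of (a, b) this is a quotient; at a zero it is dominated by
   the sup norm of (a, b). *)
Lemma continuous_scal (l : Z -> R) : continuous l ->
  (forall z, `|scal (p z) (s z) (a z) (b z) * l z| <= sup2 (a z) (b z)) ->
  continuous (fun z => scal (p z) (s z) (a z) (b z) * l z).
Proof.
move=> cl hl z.
have [h|h] := eqVneq (sup2 (a z) (b z)) 0.
  have e : scal (p z) (s z) (a z) (b z) * l z = 0.
    by apply/eqP; rewrite -normr_le0 -h.
  rewrite /continuous_at e; apply/norm_cvg0P => /=.
  apply: (@squeeze_cvgr _ _ _ _ (cst 0) (fun t => sup2 (a t) (b t))).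
  - by near=> t; rewrite normr_ge0 hl.
  - exact: cvg_cst.
  - by rewrite -h; exact: continuous_sup2.
apply: cvgM; last exact: cl.
apply: cvgM; first exact: continuous_sup2.
apply: cvgV; last exact: continuous_sup2.
by apply: contra h => /eqP/(lin_eq0 (ps z)) ->.
Unshelve. all: by end_near.
Qed.

Lemma continuous_rot1 : continuous (fun z => rot1 (p z) (s z) (a z) (b z)).
Proof.
apply: continuous_scal => // z.
by rewrite -(sup2_rot _ _ (ps z)) le_max lexx.
Qed.

Lemma continuous_rot2 : continuous (fun z => rot2 (p z) (s z) (a z) (b z)).
Proof.
apply: continuous_scal => // z.
by rewrite -(sup2_rot _ _ (ps z)) le_max lexx orbT.
Qed.

End rot.
End square_rotation_continuous.

Section absorb.
Variable R : realType.
Implicit Types (w y u v a : R) (q : nat -> R).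

(** A full quarter turn for w <= 1/2, which exchanges the short coordinate for one of full width; it
    unwinds to the identity as w grows from 1/2 to 1. *)
Definition angle w := Num.min 1 (2 - 2 * w).
Definition dbl w := Num.min 1 (2 * w).
(** Dividing by [Num.max w (1 / 2)] stretches [-w, w] to [-1, 1] when w >= 1/2 and merely doubles it
    otherwise, so that nothing blows up at w = 0. *)
Definition phi1 w y a :=
  rot1 (1 - angle w) (angle w) (y / Num.max w (1 / 2)) a.
Definition phi2 w y a :=
  rot2 (1 - angle w) (angle w) (y / Num.max w (1 / 2)) a.

(* For every w in [0, 1], sending (y, q) to the sequence of the [absorb n w y q]
   is a bijection of [-w, w] x [-1, 1]^nat onto [-1, 1]^nat: the extra coordinate
   moves along the sequence, its range doubling at every step until it is
   [-1, 1]; for w = 0 it never settles. *)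
Fixpoint absorb n w y q : R :=
  if n is n'.+1 then absorb n' (dbl w) (phi2 w y (q 0%N)) (q \o S)
  else phi1 w y (q 0%N).

Lemma angle_gt0 w : 0 < (1 - angle w) ^+ 2 + angle w ^+ 2.
Proof. by move: (angle w) => t; have := sqr_ge0 (2 * t - 1); nra. Qed.

Lemma phi_small w y a : 2 * w <= 1 -> phi1 w y a = a /\ phi2 w y a = - (2 * y).
Proof.
move=> w2; rewrite /phi1 /phi2.
have -> : angle w = 1 by apply/min_idPl; lra.
have -> : Num.max w (1 / 2) = 1 / 2 by apply/max_idPr; lra.
by rewrite subrr; have [-> ->] := rot_quarter (y / (1 / 2)) a; split=> //; lra.
Qed.

Lemma phi_1 y a : phi1 1 y a = y /\ phi2 1 y a = a.
Proof.
rewrite /phi1 /phi2.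
have -> : angle 1 = 0 :> R by rewrite /angle mulr1 subrr; exact/min_idPr.
have -> : Num.max 1 (1 / 2) = 1 :> R by apply/max_idPl; lra.
by rewrite subr0 divr1; exact: rot_id.
Qed.

Lemma dbl_bound w : 0 <= w <= 1 -> 0 <= dbl w <= 1.
Proof. by move=> ?; rewrite /dbl; case: (leP 1 (2 * w)) => ?; lra. Qed.

Lemma dbl_large w : 1 <= 2 * w -> dbl w = 1.
Proof. by move=> ?; exact/min_idPl. Qed.

Lemma dbl_small w : 2 * w <= 1 -> dbl w = 2 * w.
Proof. by move=> ?; exact/min_idPr. Qed.

Lemma phi_bound w y a : 0 <= w <= 1 -> `|y| <= w -> `|a| <= 1 ->
  `|phi1 w y a| <= 1 /\ `|phi2 w y a| <= dbl w.
Proof.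
move=> w01 yw a1; have [w2|w2] := leP (2 * w) 1.
  rewrite dbl_small//; have [-> ->] := phi_small y a w2.
  by rewrite normrN normrM ger0_norm//; lra.
rewrite dbl_large; last lra.
apply/andP; rewrite -sup2_le1 /phi1 /phi2 sup2_rot ?angle_gt0// sup2_le1 a1 andbT.
have -> : Num.max w (1 / 2) = w by apply/max_idPl; lra.
by rewrite normrM normfV (ger0_norm (_ : 0 <= w)) ?ler_pdivrMr; lra.
Qed.

Lemma phi_inj w y a y' a' : 0 < w ->
  phi1 w y a = phi1 w y' a' -> phi2 w y a = phi2 w y' a' -> y = y' /\ a = a'.
Proof.
move=> w0 e1 e2.
have m0 : Num.max w (1 / 2) != 0 by rewrite gt_eqF// lt_max w0.
have [f1 f2] := rotK (y / Num.max w (1 / 2)) a (angle_gt0 w).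
have [g1 g2] := rotK (y' / Num.max w (1 / 2)) a' (angle_gt0 w).
move: f1 f2 g1 g2; rewrite -/(phi1 w y a) -/(phi2 w y a) -/(phi1 w y' a')
  -/(phi2 w y' a') e1 e2 => -> -> /(congr1 ( *%R^~ (Num.max w (1 / 2)))) + ->.
by rewrite !divfK.
Qed.

Lemma phi_surj w u v : 0 < w <= 1 -> `|u| <= 1 -> `|v| <= dbl w ->
  exists y a, [/\ `|y| <= w, `|a| <= 1, phi1 w y a = u & phi2 w y a = v].
Proof.
move=> w01 u1 vw; have [w2|w2] := leP (2 * w) 1.
  exists (- v / 2), u; have [-> ->] := phi_small (- v / 2) u w2; split => //.
    by move: vw; rewrite dbl_small// normrM normrN ger0_norm; lra.
  by field.
pose c := Num.max w (1 / 2).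
have cw : c = w by apply/max_idPl; lra.
have c0 : c != 0 by rewrite cw gt_eqF//; lra.
pose t := angle w.
exists (c * rot1 (1 - t) (- t) u v), (rot2 (1 - t) (- t) u v).
have [h1 h2] : `|rot1 (1 - t) (- t) u v| <= 1 /\ `|rot2 (1 - t) (- t) u v| <= 1.
  apply/andP; rewrite -sup2_le1 sup2_rot; last by rewrite sqrrN angle_gt0.
  by move: vw; rewrite sup2_le1 u1 dbl_large//; lra.
have [e1 e2] := rotVK u v (angle_gt0 w).
split => //; last 2 first.
- by rewrite /phi1 mulrAC divff// mul1r.
- by rewrite /phi2 mulrAC divff// mul1r.
rewrite normrM cw ger0_norm; last lra.
by rewrite ger_pMr//; lra.
Qed.

Lemma absorb_0 n q : absorb n 0 0 q = q n.
Proof.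
elim: n q => [|n IH] q /=; have [|e1 e2] := @phi_small 0 0 (q 0%N); try lra.
by rewrite e2 mulr0 oppr0 dbl_small ?mulr0 ?IH//; lra.
Qed.

(** At full width the rotation is the identity and absorption is a shift of the sequence; the
    inductions on the number of doublings end here. *)
Lemma absorb_1 n y q : absorb n 1 y q = if n is n'.+1 then q n' else y.
Proof.
elim: n y q => [|n IH] y q /=; have [e1 e2] := phi_1 y (q 0%N) => //.
by rewrite e2 dbl_large ?IH//; [case: n {IH}|lra].
Qed.

Lemma absorb_bound n w y q : 0 <= w <= 1 -> `|y| <= w ->
  (forall m, `|q m| <= 1) -> `|absorb n w y q| <= 1.
Proof.
elim: n w y q => [|n IH] w y q w01 yw q1 /=;
  have [h1 h2] := phi_bound w01 yw (q1 0%N) => //.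
by apply: IH => // [|m]; [exact: dbl_bound|exact: q1].
Qed.

Lemma pow_dbl N w : 0 < w <= 1 -> 1 <= 2 ^+ N.+1 * w -> 1 <= 2 ^+ N * dbl w.
Proof.
move=> w01 h; have [w2|w2] := leP (2 * w) 1.
  by rewrite dbl_small// mulrA -exprSr.
by rewrite dbl_large ?mulr1 ?exprn_ege1//; lra.
Qed.

Lemma dbl_gt0 w : 0 < w <= 1 -> 0 < dbl w <= 1.
Proof. by move=> ?; rewrite /dbl; case: (leP 1 (2 * w)) => ?; lra. Qed.

Lemma pow_ge w : 0 < w -> exists N, 1 <= 2 ^+ N * w.
Proof.
move=> w0; exists (Num.truncn w^-1).+1; rewrite -ler_pdivrMr// mul1r.
apply: le_trans (ltW (Num.Theory.truncnS_gt _)) _.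
by rewrite -natrX ler_nat ltnW// ltn_expl.
Qed.

(** For w = 0 the sequence is unchanged and y can only be 0. For w > 0 the width reaches 1 after
    finitely many doublings, and each doubling undoes one invertible rotation. Surjectivity follows
    the same pattern. *)
Lemma absorb_inj w y q y' q' : 0 <= w <= 1 -> `|y| <= w -> `|y'| <= w ->
  (forall n, absorb n w y q = absorb n w y' q') -> y = y' /\ forall n, q n = q' n.
Proof.
move=> w01 yw yw' e; have [w0|w0] := eqVneq w 0.
  move: yw yw' e; rewrite w0 !normr_le0 => /eqP -> /eqP -> e.
  by split=> // n; have := e n; rewrite !absorb_0.
have {}w01 : 0 < w <= 1 by rewrite lt_neqAle eq_sym w0.
have [N hN] := pow_ge (proj1 (andP w01)).
elim: N w y q y' q' w01 hN e {yw yw' w0} => [|N IH] w y q y' q' w01 hN e.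
  have w1 : w = 1 by move: hN; rewrite mul1r; lra.
  split; first by have := e 0%N; rewrite w1 !absorb_1.
  by move=> n; have := e n.+1; rewrite w1 !absorb_1.
have [e2 eq] := IH _ _ _ _ _ (dbl_gt0 w01) (pow_dbl w01 hN) (fun n => e n.+1).
have [ey e0] := phi_inj (proj1 (andP w01)) (e 0%N) e2.
by split=> // -[|n]//; exact: eq.
Qed.

Lemma absorb_surj w (u : nat -> R) : 0 <= w <= 1 -> (forall n, `|u n| <= 1) ->
  exists y q, [/\ `|y| <= w, forall n, `|q n| <= 1 &
    forall n, absorb n w y q = u n].
Proof.
move=> w01 u1; have [w0|w0] := eqVneq w 0.
  by exists 0, u; rewrite w0 normr0; split=> // n; rewrite absorb_0.
have {}w01 : 0 < w <= 1 by rewrite lt_neqAle eq_sym w0.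
have [N hN] := pow_ge (proj1 (andP w01)).
elim: N w u u1 w01 hN {w0} => [|N IH] w u u1 w01 hN.
  have w1 : w = 1 by move: hN; rewrite mul1r; lra.
  exists (u 0%N), (u \o S); rewrite w1; split => // [n|n]; first exact: u1.
  by rewrite absorb_1; case: n.
have [y' [q' [y'w q'1 e]]] :=
  IH _ (u \o S) (fun n => u1 n.+1) (dbl_gt0 w01) (pow_dbl w01 hN).
have [y [a [yw a1 e1 e2]]] := phi_surj w01 (u1 0%N) y'w.
exists y, (fun n => if n is m.+1 then q' m else a); split => //.
  by case.
move=> [//|n] /=; rewrite e2; exact: e.
Qed.

Lemma continuous_absorb n (Z : topologicalType) (w y : Z -> R) (q : Z -> nat -> R) :
  continuous w -> continuous y -> (forall m, continuous (q ^~ m)) ->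
  continuous (fun z => absorb n (w z) (y z) (q z)).
Proof.
elim: n w y q => [|n IH] w y q cw cy cq /=.
all: have c2 : continuous (cst 2 : Z -> R) by exact: continuous_cst2.
all: have c1 : continuous (cst 1 : Z -> R) by exact: continuous_cst2.
all: have ca : continuous (fun z => angle (w z)) by
  apply: continuous_min2 => //; apply: continuousB2 => //; exact: continuousM2.
all: have ca' : continuous (fun z => 1 - angle (w z)) by exact: continuousB2.
all: have cm : continuous (fun z => y z / Num.max (w z) (1 / 2)) by
  (apply: continuousM2 => //; apply: continuousV2;
    [by move=> z; rewrite gt_eqF// lt_max; apply/orP; right; lra
    |by apply: continuous_max2 => //; exact: continuous_cst2]).
  by apply: continuous_rot1 => // z; exact: angle_gt0.
apply: (IH (dbl \o w) (fun z => phi2 (w z) (y z) (q z 0%N)) (fun z => q z \o S)).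
- by apply: continuous_min2 => //; exact: continuousM2.
- by apply: continuous_rot2 => // z; exact: angle_gt0.
- by move=> m; exact: cq.
Qed.

End absorb.

(** * Towers of intervals *)

(** Continuity for the product topology, tested on all continuous families; in this form it applies
    directly to the coordinate maps of the completion, and [K -> R] needs no topology. *)
Definition cylindrical (R : realType) (K : Type) (g : (K -> R) -> R) : Prop :=
  forall (Z : topologicalType) (x : Z -> K -> R),
    (forall i, continuous (x ^~ i)) -> continuous (fun z => g (x z)).

(** * Fixed points of recursions along a rank *)

Section causal.
Variables (V : Type) (v0 : V) (K : Type) (rk : K -> nat).
Variable Phi : (K -> V) -> K -> V.
Hypothesis causal : forall x y i,
  (forall j, (rk j < rk i)%N -> x j = y j) -> Phi x i = Phi y i.

Lemma causal_fixpoint_unique x y : Phi x = x -> Phi y = y -> x = y.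
Proof.
move=> fx fy; apply/funext => i.
have [n] := ubnP (rk i); elim: n i => // n IH i ri.
by rewrite -fx -fy; apply: causal => j ji; apply: IH; lia.
Qed.

Lemma causal_fixpoint_exists : exists x, Phi x = x.
Proof.
pose s n := iter n Phi (fun=> v0).
(* Each application of [Phi] settles the coordinates of one more rank. *)
have st n m i : (rk i < n)%N -> (n <= m)%N -> s n i = s m i.
  elim: n m i => // n IH [//|m] i ri nm; rewrite /s !iterS.
  by apply: causal => j ji; apply: IH; lia.
exists (fun i => s (rk i).+1 i); apply/funext => i.
rewrite [RHS]/s iterS; apply: causal => j ji.
by apply: st; lia.
Qed.

End causal.

(** * Straightening a tower by absorption *)

Section triangular.
Variables (R : realType) (K : Type) (rk : K -> nat).
Variables (mid w : K -> (K -> R) -> R) (free : nat -> K) (code : K -> nat -> nat).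
Implicit Types (x y : K -> R) (u : nat -> R) (i : K) (j m : nat).

Definition tower x := forall i, `|x i - mid i x| <= w i x.

Hypothesis mid_causal : forall i x y,
  (forall k, (rk k < rk i)%N -> x k = y k) -> mid i x = mid i y.
Hypothesis w_causal : forall i x y,
  (forall k, (rk k < rk i)%N -> x k = y k) -> w i x = w i y.
Hypothesis w01 : forall i x,
  (forall k, (rk k < rk i)%N -> `|x k - mid k x| <= w k x) -> 0 <= w i x <= 1.
Hypothesis free_inj : injective free.
Hypothesis mid_free : forall j x, mid (free j) x = 1 / 2.
Hypothesis w_free : forall j x, w (free j) x = 1 / 2.
Hypothesis code_inj : forall i m i' m', code i m = code i' m' -> i = i' /\ m = m'.
Hypothesis code_rk : forall i m, (rk i <= rk (free (code i m)))%N.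
Hypothesis mid_cont : forall i, cylindrical (mid i).
Hypothesis w_cont : forall i, cylindrical (w i).

Let tied i := ~ exists j, free j = i.

(** The tied coordinate and the slot for which the free coordinate j is reserved; an unreserved free
    coordinate is passed on unchanged. *)
Let host j : option (K * nat) :=
  if pselect (exists im : K * nat, tied im.1 /\ code im.1 im.2 = j) is left e
  then Some (sval (cid e)) else None.

Let host_code i m : tied i -> host (code i m) = Some (i, m).
Proof.
move=> ti; rewrite /host; case: pselect => [e|[]]; last by exists (i, m).
case: cid => -[i' m'] /= [_ /code_inj[-> ->]] //.
Qed.

Let host_Some j i m : host j = Some (i, m) -> tied i /\ code i m = j.
Proof.
by rewrite /host; case: pselect => // e; case: cid => -[i' m'] /= + [<- <-].
Qed.

Let fv x j := 2 * x (free j) - 1.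

Let G x j := if host j is Some (i, m)
  then absorb m (w i x) (x i - mid i x) (fv x \o code i) else fv x j.

Let solves v u (yq : R * (nat -> R)) :=
  [/\ `|yq.1| <= v, forall n, `|yq.2 n| <= 1 &
      forall n, absorb n v yq.1 yq.2 = u n].

(** The choice depends on the width and the target alone, so it inherits causality from the width;
    the default value is never met for widths in [0, 1] and targets in the cube. *)
Let ainv v u : R * (nat -> R) :=
  if pselect (exists yq, solves v u yq) is left e then sval (cid e)
  else (0, fun=> 0).

Let ainvP v u : 0 <= v <= 1 -> (forall n, `|u n| <= 1) -> solves v u (ainv v u).
Proof.
move=> v01 u1; rewrite /ainv; case: pselect => [e|[]]; first by case: cid.
by have [y [q ?]] := absorb_surj v01 u1; exists (y, q).
Qed.

(** The equation [G x = u] solved for the coordinate i: its fixed points are the preimages of u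
    under [G]. *)
Let Phi u x i :=
  if pselect (exists j, free j = i) is left e then
    let j := sval (cid e) in
    (1 + if host j is Some (i', m) then (ainv (w i' x) (u \o code i')).2 m
         else u j) / 2
  else mid i x + (ainv (w i x) (u \o code i)).1.

Let Phi_free u x j : Phi u x (free j) =
  (1 + if host j is Some (i', m) then (ainv (w i' x) (u \o code i')).2 m
         else u j) / 2.
Proof.
rewrite /Phi; case: pselect => [e|[]]; last by exists j.
by case: cid => j' /= /free_inj ->.
Qed.

Let Phi_tied u x i : tied i ->
  Phi u x i = mid i x + (ainv (w i x) (u \o code i)).1.
Proof. by move=> ti; rewrite /Phi; case: pselect. Qed.

(** A reserved free coordinate is decoded with the width at its host i', which involves ranks below
    [rk i'] only; [code_rk] puts these below the rank of the free coordinate. *)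
Let Phi_causal u x y i :
  (forall k, (rk k < rk i)%N -> x k = y k) -> Phi u x i = Phi u y i.
Proof.
move=> xy; have [[j ji]|ti] := pselect (exists j, free j = i).
  rewrite -ji !Phi_free; case hj : (host j) => [[i' m]|//].
  have [_ cj] := host_Some hj.
  rewrite (@w_causal i' x y)// => k ki; apply: xy.
  by rewrite -ji -cj (leq_trans ki).
by rewrite !Phi_tied// (mid_causal xy) (w_causal xy).
Qed.

Let fv_bound x j : tower x -> `|fv x j| <= 1.
Proof.
move=> /(_ (free j)); rewrite mid_free w_free /fv !ler_norml; lra.
Qed.

Let tower_w x i : tower x -> 0 <= w i x <= 1.
Proof. by move=> Tx; apply: w01 => k _; exact: Tx. Qed.

Let G_fix x u : tower x -> (forall j, `|u j| <= 1) -> G x = u -> Phi u x = x.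
Proof.
move=> Tx u1 Gu.
have key i m : tied i ->
    (ainv (w i x) (u \o code i)).1 = x i - mid i x /\
    (ainv (w i x) (u \o code i)).2 m = fv x (code i m).
  move=> ti; have [h1 h2 h3] := ainvP (tower_w i Tx) (fun n => u1 (code i n)).
  have [n|e1 e2] := @absorb_inj _ _ _ (ainv (w i x) (u \o code i)).2 _
      (fv x \o code i) (tower_w i Tx) h1 (Tx i).
    by rewrite h3 -Gu /= /G host_code.
  by split => //; exact: e2.
apply/funext => i; have [[j ji]|ti] := pselect (exists j, free j = i).
  rewrite -ji Phi_free; case hj : (host j) => [[i' m]|].
    have [ti cj] := host_Some hj.
    by rewrite (key i' m ti).2 cj /fv; field.
  by rewrite -Gu /G hj /fv; field.
by rewrite Phi_tied// (key i 0%N ti).1; ring.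
Qed.

(** Strong induction on the rank: the bounds at smaller ranks put the width into [0, 1], and only
    then does [ainvP] bound the decoded value. *)
Let fix_tower x u : (forall j, `|u j| <= 1) -> Phi u x = x -> tower x.
Proof.
move=> u1 fx i; have [n] := ubnP (rk i); elim: n i => // n IH i ri.
have wk k : (rk k <= rk i)%N -> 0 <= w k x <= 1.
  by move=> ki; apply: w01 => l lk; apply: IH; lia.
rewrite -{1}fx; have [[j ji]|ti] := pselect (exists j, free j = i); last first.
  rewrite Phi_tied// addrAC subrr add0r.
  by have [] := ainvP (wk i (leqnn _)) (fun n => u1 (code i n)).
rewrite -ji Phi_free mid_free w_free.
suff : `|if host j is Some (i', m) then (ainv (w i' x) (u \o code i')).2 m else u j| <= 1.
  by move: (if _ is Some _ then _ else _) => t; rewrite !ler_norml; lra.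
case hj : (host j) => [[i' m]|//].
have [ti cj] := host_Some hj.
have [|_ h _] := ainvP (wk i' _) (fun n => u1 (code i' n)); last exact: h.
by rewrite -ji -cj.
Qed.

Let fix_G x u : (forall j, `|u j| <= 1) -> Phi u x = x -> G x = u.
Proof.
move=> u1 fx; have Tx := fix_tower u1 fx; apply/funext => j.
have fvE k : fv x k = if host k is Some (i', m)
    then (ainv (w i' x) (u \o code i')).2 m else u k.
  by rewrite /fv -[in LHS]fx Phi_free; field.
rewrite /G; case hj : (host j) => [[i m]|]; last by rewrite fvE hj.
have [ti cj] := host_Some hj.
have [h1 h2 h3] := ainvP (tower_w i Tx) (fun n => u1 (code i n)).
rewrite -cj; apply/esym; rewrite -[LHS]h3; apply/esym.
have -> : x i - mid i x = (ainv (w i x) (u \o code i)).1.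
  by rewrite -{1}fx Phi_tied//; ring.
congr (absorb _ _ _ _); apply/funext => n /=.
by rewrite fvE host_code.
Qed.

(* The tied coordinate i is absorbed by the free coordinates
   [free (code i 0)], [free (code i 1)], ... *)
Lemma tower_cube : exists H : (K -> R) -> nat -> R,
  [/\ forall j, cylindrical (H ^~ j),
      forall x, tower x -> forall j, `|H x j| <= 1,
      forall x y, tower x -> tower y -> H x = H y -> x = y &
      forall u, (forall j, `|u j| <= 1) -> exists2 x, tower x & H x = u].
Proof.
have Gb x : tower x -> forall j, `|G x j| <= 1.
  move=> Tx j; rewrite /G; case: (host j) => [[i m]|]; last exact: fv_bound.
  apply: absorb_bound; [exact: tower_w|exact: Tx|].
  by move=> n; exact: fv_bound.
exists G; split => // [j Z x cx|x y Tx Ty Gxy|u u1].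
- have cfv k : continuous (fun z => fv (x z) k).
    apply: continuousB2; last exact: continuous_cst2.
    by apply: continuousM2; [exact: continuous_cst2|exact: cx].
  rewrite /G; case: (host j) => [[i m]|//].
  apply: (continuous_absorb (y := fun z => _) (q := fun z => fv (x z) \o code i)).
  + exact: w_cont.
  + by apply: continuousB2 => //; exact: mid_cont.
  + by move=> k; exact: cfv.
(* Both points are fixed by the operator for the common target. *)
- apply: (causal_fixpoint_unique (@Phi_causal (G y))); apply: G_fix => //; exact: Gb.
- have [x fx] := causal_fixpoint_exists 0 (@Phi_causal u).
  by exists x; [exact: fix_tower fx|exact: fix_G].
Qed.

End triangular.

(** * Integrals of step functions *)

Section step_integral.
Variables (R : realType) (X : topologicalType).
Implicit Types (alpha beta : HM R X) (phi psi : X -> R) (a b c : R).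
Notation mu := (@lebesgue_measure R).

Definition stepf phi alpha : R -> R := 'valL_ 0 (phi \o alpha).

Lemma stepfE phi alpha (u : Ico01 R) : stepf phi alpha (set_val u) = phi (alpha u).
Proof. exact: (congr1 (@^~ u) (valLK 0 (phi \o alpha))). Qed.

Lemma Ico01_val (t : R) : 0 <= t < 1 -> exists u : Ico01 R, set_val u = t.
Proof.
move=> t01; have h : Ico01 R t by rewrite /Ico01 /= in_itv.
by exists (SigSub (mem_set h)).
Qed.

Lemma partition_mono (t : nat -> R) n : (forall i, (i < n)%N -> t i <= t i.+1) ->
  forall i j, (i <= j <= n)%N -> t i <= t j.
Proof.
move=> tm i; elim=> [|j IH] /andP[ij jn]; first by move: ij; rewrite leqn0 => /eqP ->.
move: ij; rewrite leq_eqVlt => /orP[/eqP -> //|ij].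
by apply: le_trans (IH _) (tm _ _); lia.
Qed.

Lemma stepf_nice phi alpha : measurable_fun `[(0 : R), 1[ (stepf phi alpha) /\
  exists M : R, forall t : R, 0 <= t < 1 -> `|stepf phi alpha t| <= M.
Proof.
have [n [t [t0 t1 tm tc]]] := hm_step alpha.
have mono := partition_mono tm.
suff h i : (i <= n)%N -> measurable_fun `[(0 : R), t i[ (stepf phi alpha) /\
    exists M : R, forall s : R, 0 <= s < t i -> `|stepf phi alpha s| <= M.
  by have := h n (leqnn n); rewrite t1.
elim: i => [|i IH] ilt.
  rewrite t0; split; last by exists 0 => s; lra.
    by rewrite set_itv_ge -?leNgt ?bnd_simp//; exact: measurable_fun_set0.
have [mi [M hM]] := IH (ltnW ilt).
have t0i : 0 <= t i by rewrite -t0; apply: mono; lia.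
have tin : t i.+1 <= 1 by rewrite -t1; apply: mono; lia.
have tii := tm i ilt.
have cst_i : exists v, forall s, t i <= s < t i.+1 -> stepf phi alpha s = v.
  have [h|h] := leP (t i.+1) (t i); first by exists 0 => s; lra.
  have [u0 hu0] := @Ico01_val (t i) (ltac:(lra)).
  exists (phi (alpha u0)) => s hs.
  have [u hu] := @Ico01_val s (ltac:(lra)).
  rewrite -hu stepfE; congr phi; apply: (tc i ilt); rewrite ?hu//.
  by rewrite hu0 lexx.
have [v hv] := cst_i; split.
  have -> : `[0, t i.+1[%classic = `[0, t i[%classic `|` `[t i, t i.+1[%classic :> set R.
    by rewrite -itv_bndbnd_setU ?bnd_simp.
  apply/measurable_funU => //; split => //.
  apply: (eq_measurable_fun (cst v)) => // s; rewrite inE /= in_itv /= => hs.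
  by rewrite hv.
exists (Num.max M `|v|) => s hs; rewrite le_max.
have [si|si] := ltP s (t i); first by rewrite hM//; lra.
by rewrite hv ?lexx ?orbT//; lra.
Qed.

Lemma stepf_integrable phi alpha a b : 0 <= a -> b <= 1 ->
  mu.-integrable `[a, b[ (EFin \o stepf phi alpha).
Proof.
move=> a0 b1; have [mf [M hM]] := stepf_nice phi alpha.
have sub : (`[a, b[%classic : set R) `<=` `[0, 1[%classic.
  by move=> t /=; rewrite !in_itv /=; lra.
apply: measurable_bounded_integrable => //.
- by rewrite /= lebesgue_measure_itv /=; case: ifP => // _; rewrite -EFinB ltry.
- exact: measurable_funS mf.
- exists M; split; first exact: num_real.
  move=> y My t /= /sub /=; rewrite in_itv /= => ht.
  by apply: le_trans (hM _ ht) (ltW My).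
Qed.

Definition hint phi a b alpha : R := \int[mu]_(t in `[a, b[) stepf phi alpha t.

Lemma hm_avgE phi a b alpha : hm_avg phi a b alpha = (b - a)^-1 * hint phi a b alpha.
Proof. by []. Qed.

Lemma hintU phi alpha a b c : 0 <= a -> a <= b -> b <= c -> c <= 1 ->
  hint phi a c alpha = hint phi a b alpha + hint phi b c alpha.
Proof.
move=> a0 ab bc c1; rewrite /hint.
have e : `[a, c[%classic = `[a, b[%classic `|` `[b, c[%classic :> set R.
  by rewrite -itv_bndbnd_setU ?bnd_simp.
rewrite e Rintegral_setU//; first by rewrite -e; exact: stepf_integrable.
by apply/disj_setPS => y [/=]; rewrite !in_itv /=; lra.
Qed.

Lemma eq_hint phi psi alpha beta a b : 0 <= a -> b <= 1 ->
  (forall u, a <= set_val u < b -> phi (alpha u) = psi (beta u)) ->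
  hint phi a b alpha = hint psi a b beta.
Proof.
move=> a0 b1 e; apply: eq_Rintegral => t; rewrite inE /= in_itv /= => tab.
have [u hu] := @Ico01_val t (ltac:(lra)).
by rewrite -hu !stepfE e// hu.
Qed.

Lemma hint_cst phi alpha a b v : 0 <= a -> a <= b -> b <= 1 ->
  (forall u, a <= set_val u < b -> phi (alpha u) = v) ->
  hint phi a b alpha = v * (b - a).
Proof.
move=> a0 ab b1 e; transitivity (\int[mu]_(t in `[a, b[) v).
  apply: eq_Rintegral => t; rewrite inE /= in_itv /= => tab.
  have [u hu] := @Ico01_val t (ltac:(lra)).
  by rewrite -hu stepfE e// hu.
rewrite Rintegral_cst//= lebesgue_measure_itv /= lte_fin.
by case: ltP => // h; rewrite (_ : b - a = 0) ?mulr0//=; lra.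
Qed.

Lemma hintD phi psi alpha a b : 0 <= a -> b <= 1 ->
  hint (fun x => phi x + psi x) a b alpha = hint phi a b alpha + hint psi a b alpha.
Proof.
move=> a0 b1; rewrite /hint -RintegralD//; [|exact: stepf_integrable..].
apply: eq_Rintegral => t; rewrite inE /= in_itv /= => tab.
by have [u <-] := @Ico01_val t (ltac:(lra)); rewrite !stepfE.
Qed.

Lemma hintZ k phi alpha a b : 0 <= a -> b <= 1 ->
  hint (fun x => k * phi x) a b alpha = k * hint phi a b alpha.
Proof.
move=> a0 b1; rewrite /hint -RintegralZl//; last exact: stepf_integrable.
apply: eq_Rintegral => t; rewrite inE /= in_itv /= => tab.
by have [u <-] := @Ico01_val t (ltac:(lra)); rewrite !stepfE.
Qed.

Lemma hint_sum (I : Type) (r : seq I) (P : pred I) (k : I -> R) (phi : I -> X -> R)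
    alpha a b : 0 <= a -> a <= b -> b <= 1 ->
  hint (fun x => \sum_(i <- r | P i) k i * phi i x) a b alpha =
  \sum_(i <- r | P i) k i * hint (phi i) a b alpha.
Proof.
move=> a0 ab b1; elim: r => [|i r IH].
  by rewrite big_nil (@hint_cst _ _ _ _ 0) ?mul0r// => u _; rewrite big_nil.
rewrite big_cons; case: ifP => Pi.
  rewrite -IH -hintZ// -hintD//; apply: eq_hint => // u _.
  by rewrite big_cons Pi.
by rewrite -IH; apply: eq_hint => // u _; rewrite big_cons Pi.
Qed.

Lemma le_hint phi psi alpha a b : 0 <= a -> b <= 1 ->
  (forall x, phi x <= psi x) -> hint phi a b alpha <= hint psi a b alpha.
Proof.
move=> a0 b1 h; apply: le_Rintegral => //; [exact: stepf_integrable..|].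
move=> t /=; rewrite in_itv /= => tab.
by have [u <-] := @Ico01_val t (ltac:(lra)); rewrite !stepfE.
Qed.

Lemma hint_bound phi alpha a b M : 0 <= a -> a <= b -> b <= 1 ->
  (forall x, `|phi x| <= M) -> `|hint phi a b alpha| <= M * (b - a).
Proof.
move=> a0 ab b1 h; rewrite ler_norml; apply/andP; split.
  rewrite -mulNr -(@hint_cst (fun=> - M) alpha a b)//.
  by apply: le_hint => // x; have := h x; rewrite ler_norml => /andP[].
rewrite -(@hint_cst (fun=> M) alpha a b)//.
by apply: le_hint => // x; have := h x; rewrite ler_norml => /andP[].
Qed.

Lemma hint_dist phi psi alpha a b e : 0 <= a -> a <= b -> b <= 1 ->
  (forall x, `|phi x - psi x| <= e) ->
  `|hint phi a b alpha - hint psi a b alpha| <= e * (b - a).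
Proof.
move=> a0 ab b1 h; rewrite -(mulN1r (hint psi _ _ _)) -hintZ// -hintD//.
by apply: hint_bound => // x; rewrite mulN1r.
Qed.

Lemma HM_cst (x : X) : exists alpha : HM R X, forall u, alpha u = x.
Proof.
have h : step_function (fun _ : Ico01 R => x).
  by exists 1%N, (fun i => i%:R); split => // i _; rewrite ler_nat.
by exists (HMap h).
Qed.

Lemma HM_glue alpha beta c : 0 <= c <= 1 -> exists gam : HM R X,
  (forall u, set_val u < c -> gam u = alpha u) /\
  (forall u, c <= set_val u -> gam u = beta u).
Proof.
move=> c01.
have [n [t [t0 t1 tm tc]]] := hm_step alpha.
have [m [s [s0 s1 sm sc]]] := hm_step beta.
(* The break points of [alpha] cut off at c, followed by those of [beta] raised to c. The interval
   from index n to n + 1 is [c, c[, hence empty. *)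
pose r i := if (i <= n)%N then Num.min (t i) c else Num.max (s (i - n.+1)%N) c.
have rn i : (i <= n)%N -> r i = Num.min (t i) c by rewrite /r => ->.
have rm i : r (n.+1 + i)%N = Num.max (s i) c.
  by rewrite /r addKn (_ : (_ <= n)%N = false)//; lia.
have split_i i : (i < n.+1 + m)%N -> [\/ (i < n)%N, i = n |
    exists2 j, (j < m)%N & i = (n.+1 + j)%N].
  move=> ilt; have [?|?|?] := ltngtP i n; [exact: Or31| |exact: Or32].
  by apply: Or33; exists (i - n.+1)%N; lia.
have hg : step_function (fun u : Ico01 R => if set_val u < c then alpha u else beta u).
  exists (n.+1 + m)%N, r; split.
  - by rewrite rn// t0; apply/min_idPl; lra.
  - by rewrite rm s1; apply/max_idPl; lra.
  - move=> i /split_i[ilt|->|[j jm ->]].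
    + rewrite (rn i (ltnW ilt)) (rn i.+1 ilt); have := tm i ilt.
      by case: (leP (t i) c) => ?; case: (leP (t i.+1) c) => ? ?; lra.
    + rewrite (rn n)// -[in leRHS](addn0 n.+1) rm s0 t1.
      by case: (leP 1 c) => ?; case: (leP 0 c) => ?; lra.
    + rewrite -addnS !rm; have := sm j jm.
      by case: (leP (s j) c) => ?; case: (leP (s j.+1) c) => ? ?; lra.
  - move=> i /split_i[ilt|->|[j jm ->]] x y.
    + rewrite (rn i (ltnW ilt)) (rn i.+1 ilt) !lt_min => hx hy.
      have e u : Num.min (t i) c <= set_val u ->
          (set_val u < t i.+1) && (set_val u < c) -> t i <= set_val u < t i.+1.
        by case: (leP (t i) c) => ? ? /andP[? ?]; lra.
      have xc : set_val x < c by lra.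
      have yc : set_val y < c by lra.
      case/andP: hx => hx1 hx2; case/andP: hy => hy1 hy2.
      by rewrite xc yc; apply: (tc i ilt); apply: e.
    + rewrite (rn n)// -[n.+1](addn0 n.+1) rm s0 t1.
      have -> : Num.min 1 c = c by apply/min_idPr; lra.
      have -> : Num.max 0 c = c by apply/max_idPr; lra.
      by move=> hx; exfalso; lra.
    + rewrite -addnS !rm !ge_max => hx hy.
      have e u : (s j <= set_val u) && (c <= set_val u) ->
          set_val u < Num.max (s j.+1) c -> s j <= set_val u < s j.+1.
        by case: (leP (s j.+1) c) => ? /andP[? ?] ?; lra.
      have xc : c <= set_val x by lra.
      have yc : c <= set_val y by lra.
      rewrite !ltNge xc yc /=.
      case/andP: hx => hx1 hx2; case/andP: hy => hy1 hy2.
      by apply: (sc j jm); apply: e.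
exists (HMap hg); split => u /= uc; first by rewrite uc.
by rewrite ltNge uc.
Qed.

End step_integral.

(** * Peaked partitions of unity *)

(* [pou n 0, ..., pou n n] is a partition of unity peaked at [pk 0, ..., pk n].
   The sequence [pk] may repeat itself (X may be finite); repeated points are
   not live, and their functions vanish. *)
Record peaked_system (R : realType) (X : topologicalType) := PeakedSystem {
  pk : nat -> X;
  live : nat -> bool;
  wgt : nat -> nat -> R;
  pou : nat -> nat -> X -> R;
  live1 : live 1;
  wgt_ge0 : forall n i, 0 <= wgt n i;
  wgt_sum : forall n, \sum_(i < n.+1) wgt n.+1 i = 1;
  pou_cont : forall n i, continuous (pou n i);
  pou_ge0 : forall n i x, 0 <= pou n i x;
  pou_sum : forall n x, \sum_(i < n.+1) pou n i x = 1;
  pou_refine : forall n i x, (i <= n)%N ->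
    pou n i x = pou n.+1 i x + wgt n.+1 i * pou n.+1 n.+1 x;
  pou_dead : forall n x, ~~ live n -> pou n n x = 0;
  pou_pk : forall n i j, (i <= n)%N -> (j <= n)%N -> live j ->
    pou n i (pk j) = (i == j)%:R;
  pou_dense : forall phi : X -> R, continuous phi -> forall eps : R, 0 < eps ->
    exists n (k : nat -> R), forall x,
      `|phi x - \sum_(i < n.+1) k i * pou n i x| <= eps }.

(** * Nets and bump functions in a compact metric space *)

Section compact_metric.
Variables (R : realType) (X : topologicalType) (d : X -> X -> R).
Hypothesis cptX : compact [set: X].
Hypothesis d0 : forall x y, d x y = 0 <-> x = y.
Hypothesis dC : forall x y, d x y = d y x.
Hypothesis dtri : forall x y z, d x z <= d x y + d y z.
Hypothesis dnbhs : forall x, nbhs x =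
  filter_from [set e : R | 0 < e] (fun e => [set y | d x y < e]).

Lemma dist_xx x : d x x = 0.
Proof. exact/d0. Qed.

Lemma dist_ge0 x y : 0 <= d x y.
Proof. by have := dtri x y x; rewrite dist_xx (dC y x); lra. Qed.

Lemma dist_gt0 x y : x <> y -> 0 < d x y.
Proof. by move=> xy; rewrite lt_neqAle dist_ge0 andbT; apply/eqP => /esym/d0. Qed.

Lemma nbhs_dist x (e : R) : 0 < e -> nbhs x [set y | d x y < e].
Proof. by move=> e0; rewrite dnbhs; exists e. Qed.

Lemma continuous_distP (f : X -> R) : continuous f <->
  forall x e, 0 < e -> exists2 r, 0 < r & forall y, d x y < r -> `|f x - f y| < e.
Proof.
split=> [cf x e e0|h x].
  have : nbhs x [set y | `|f x - f y| < e] by have /cvgrPdist_lt/(_ _ e0) := cf x.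
  by rewrite dnbhs => -[r /= r0 hr]; exists r.
apply/cvgrPdist_lt => e e0; suff : nbhs x [set y | `|f x - f y| < e] by [].
by rewrite dnbhs; have [r r0 hr] := h x e e0; exists r.
Qed.

Lemma continuous_dist y : continuous (d ^~ y).
Proof.
apply/continuous_distP => x e e0; exists e => // z xz.
have h1 := dtri x z y; have h2 := dtri z x y.
by rewrite (dC z x) in h2; rewrite ltr_norml; lra.
Qed.

Lemma uniformly_continuous_dist (f : X -> R) : continuous f -> forall e, 0 < e ->
  exists2 r, 0 < r & forall x y, d x y < r -> `|f x - f y| < e.
Proof.
move=> /continuous_distP cf e e0.
have /compact_near_coveringP nc := cptX.
pose P (r : R) x := forall y, d x y < r -> `|f x - f y| < e.
have : \forall r \near (0 : R)^'+, [set: X] `<=` P r.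
  apply: nc => x _; have [r r0 hr] := cf x (e / 2) (ltac:(lra)).
  exists ([set y | d x y < r / 2], [set s | s < r / 2]) => /=.
    split; first by apply: nbhs_dist; lra.
    by apply: nbhs_right_lt; lra.
  move=> [y s] /= [xy sr] z yz.
  have h1 := hr y (ltac:(lra)).
  have h2 := hr z (ltac:(have := dtri x y z; lra)).
  by move: h1 h2; rewrite !ltr_norml; lra.
move=> h; have [r [r0 hr]] : exists r, 0 < r /\ [set: X] `<=` P r.
  have : \forall r \near (0 : R)^'+, 0 < r /\ [set: X] `<=` P r.
    by near=> r; split => //; near: r.
  by move=> /(@filter_ex _ _ _ _).
by exists r => // x; apply: hr.
Unshelve. all: by end_near.
Qed.

Lemma continuous_bounded (f : X -> R) : continuous f ->
  exists2 M, 0 < M & forall x, `|f x| <= M.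
Proof.
move=> /continuous_distP cf; have /compact_near_coveringP nc := cptX.
have : \forall n \near \oo, [set: X] `<=` (fun x => `|f x| <= n%:R).
  apply: nc => x _; have [r r0 hr] := cf x 1 ltr01.
  exists ([set y | d x y < r], [set n | `|f x| + 1 <= n%:R]) => /=.
    by split; [exact: nbhs_dist|exact: nbhs_infty_ger].
  move=> [y n] /= [xy hn]; have := hr y xy.
  by have := lerB_dist (f y) (f x); rewrite distrC; lra.
move=> [N _ hN]; exists N.+1%:R; first by rewrite ltr0n.
by move=> x; apply: (hN N.+1) => //=.
Qed.

Lemma finite_net (r : R) : 0 < r -> exists s : seq X, forall x, exists2 y, y \in s & d x y < r.
Proof.
move=> r0; have /compact_near_coveringP nc := cptX.
(* Finite sequences directed by inclusion: a property that holds near each point for all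
   sufficiently large sequences then holds everywhere for a single one. *)
pose F : set_system (seq X) :=
  filter_from setT (fun s0 : seq X => [set s : seq X | {subset s0 <= s}]).
have FF : Filter F.
  apply: filter_from_filter; first by exists [::].
  move=> s1 s2 _ _; exists (s1 ++ s2) => // s /= sub.
  by split=> x xs; apply: sub; rewrite mem_cat xs ?orbT.
have : \forall s \near F, [set: X] `<=` (fun x => exists2 y, y \in s & d x y < r).
  apply: nc => x _.
  exists ([set y | d x y < r], [set s : seq X | {subset [:: x] <= s}]) => /=.
    by split; [exact: nbhs_dist|exists [:: x]].
  move=> [y s] /= [xy xs]; exists x; last by rewrite dC.
  by apply: xs; rewrite mem_head.
by move=> [s _ hs]; exists s => x; exact: (hs s).
Qed.

(** The prescribed first two terms, when distinct, make the index 1 fresh; this becomes [live1], the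
    source of the coordinates of full range. *)
Lemma dense_sequence (p q : X) : exists y : nat -> X, [/\ y 0%N = p, y 1%N = q &
  forall x (r : R), 0 < r -> exists n, d x (y n) < r].
Proof.
have /choice[S hS] : forall k : nat, exists s : seq X,
    forall x, exists2 y, y \in s & d x y < k.+1%:R^-1.
  by move=> k; apply: finite_net; rewrite invr_gt0 ltr0n.
pose dec n := if unpickle n is Some (k, i) then nth p (S k) i else p.
exists (fun n => match n with 0 => p | 1 => q | n.+2 => dec n end); split => // x r r0.
have [k hk] : exists k : nat, k.+1%:R^-1 < r.
  exists (Num.truncn r^-1); rewrite invf_plt ?posrE ?ltr0n//.
  exact: Num.Theory.truncnS_gt.
have [y yS xy] := hS k x.
exists (pickle (k, index y (S k))).+2; rewrite /dec pickleK nth_index//.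
exact: lt_trans hk.
Qed.


Section nets.
Variable y : nat -> X.
Hypothesis y_dense : forall x (r : R), 0 < r -> exists n, d x (y n) < r.

Definition fresh i : bool := `[< forall j, (j < i)%N -> y j <> y i >].

Lemma fresh_rep j : exists i, [/\ (i <= j)%N, fresh i & y i = y j].
Proof.
have ex : exists i, y i == y j by exists j.
exists (ex_minn ex); case: ex_minnP => i /eqP yij mi; split => //.
  exact: mi.
apply/asboolP => l li yli; have : (i <= l)%N by apply: mi; rewrite yli yij.
lia.
Qed.

Lemma fresh_inj i j : fresh i -> fresh j -> y i = y j -> i = j.
Proof.
move=> /asboolP hi /asboolP hj yij.
by have [/hj|/hi|//] := ltngtP i j => /(_ _); rewrite yij => /(_ erefl).
Qed.

(** The first factor confines the support to the ball of radius r; the product vanishes at all other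
    points of the net, so that the normalised functions are peaked. *)
Definition net_bump (r : R) m i x : R :=
  if fresh i then Num.max 0 (r - d x (y i)) *
    \prod_(j < m.+1 | fresh j && (j != i :> nat)) d x (y j) else 0.

(** Zero beyond m, so that sums may run over any longer range of indices. *)
Definition netf (r : R) m i x : R :=
  if (i <= m)%N then net_bump r m i x / \sum_(l < m.+1) net_bump r m l x else 0.

Definition is_net (r : R) m := 0 < r /\ forall x, exists2 n, (n <= m)%N & d x (y n) < r.

Lemma net_bump_ge0 r m i x : 0 <= net_bump r m i x.
Proof.
rewrite /net_bump; case: ifP => // _; apply: mulr_ge0; first by rewrite le_max lexx.
by apply: prodr_ge0 => j _; exact: dist_ge0.
Qed.

Lemma net_bump_cont r m i : continuous (net_bump r m i).
Proof.
rewrite /net_bump; case: (fresh i); last exact: continuous_cst2.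
apply: continuousM2.
  apply: continuous_max2; first exact: continuous_cst2.
  by apply: continuousB2; [exact: continuous_cst2|exact: continuous_dist].
elim: (index_enum _) => [|j s IH].
  by under eq_fun do rewrite big_nil; exact: continuous_cst2.
under eq_fun do rewrite big_cons.
by case: (fresh j && (j != i :> nat)) => //; apply: continuousM2 => //; exact: continuous_dist.
Qed.

(** If x lies in the net, the bump of its fresh index is positive, its own distance being left out
    of the product. Otherwise no distance vanishes and any net point within r will do. *)
Lemma net_bump_sum_gt0 r m x : is_net r m -> 0 < \sum_(l < m.+1) net_bump r m l x.
Proof.
move=> [r0 net].
suff [i [im fi xi sep]] : exists i, [/\ (i <= m)%N, fresh i, d x (y i) < r &
    forall l, (l <= m)%N -> fresh l -> l <> i -> x <> y l].
  have im' : (i < m.+1)%N by [].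
  rewrite (bigD1 (Ordinal im'))//=.
  apply: ltr_pwDl; last by apply: sumr_ge0 => l _; exact: net_bump_ge0.
  rewrite /net_bump fi; apply: mulr_gt0; first by rewrite lt_max; apply/orP; right; lra.
  apply: prodr_gt0 => l /andP[fl /eqP li].
  by apply: dist_gt0 => //; apply: sep => //; rewrite -ltnS ltn_ord.
have [[j [jm xj]]|no] := pselect (exists j, (j <= m)%N /\ x = y j).
  have [i [ij fi yij]] := fresh_rep j; exists i; split => //.
  - exact: leq_trans jm.
  - by rewrite yij -xj dist_xx.
  - by move=> l lm fl li xl; apply: li; apply: fresh_inj => //; rewrite yij -xj.
have [j jm xj] := net x.
have [i [ij fi yij]] := fresh_rep j; exists i; split => //.
- exact: leq_trans jm.
- by rewrite yij.
- by move=> l lm _ _ xl; apply: no; exists l.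
Qed.

Lemma netf_ge0 r m i x : 0 <= netf r m i x.
Proof.
rewrite /netf; case: ifP => // _; apply: divr_ge0; first exact: net_bump_ge0.
by apply: sumr_ge0 => l _; exact: net_bump_ge0.
Qed.

Lemma netf_cont r m i : is_net r m -> continuous (netf r m i).
Proof.
move=> g; rewrite /netf; case: (i <= m)%N; last exact: continuous_cst2.
apply: continuousM2; first exact: net_bump_cont.
apply: continuousV2; first by move=> x; rewrite gt_eqF ?net_bump_sum_gt0.
by apply: continuous_sum2 => l; exact: net_bump_cont.
Qed.

Lemma netf_sum r m x : is_net r m -> \sum_(l < m.+1) netf r m l x = 1.
Proof.
move=> g; under eq_bigr => l _ do rewrite /netf -ltnS ltn_ord.
by rewrite -mulr_suml divff// gt_eqF ?net_bump_sum_gt0.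
Qed.

Lemma netf_sum_ext r m x (b : nat -> R) n : (m < n)%N ->
  \sum_(l < n) netf r m l x * b l = \sum_(l < m.+1) netf r m l x * b l.
Proof.
move=> mn; rewrite -(big_mkord xpredT (fun l => netf r m l x * b l)).
rewrite (@big_cat_nat _ _ _ m.+1)//= big_mkord [X in _ + X]big_nat.
rewrite [X in _ + X]big1 ?addr0// => i /andP[mi _].
by rewrite /netf leqNgt mi mul0r.
Qed.

Lemma netf_supp r m i x : 0 < r -> netf r m i x != 0 -> d x (y i) < r.
Proof.
move=> r0; rewrite /netf /net_bump; case: (i <= m)%N; last by rewrite eqxx.
case: (fresh i); last by rewrite mul0r eqxx.
rewrite !mulf_eq0 !negb_or => /andP[/andP[+ _] _].
by case: (leP 0 (r - d x (y i))) => ?; rewrite ?eqxx// => h; rewrite -subr_gt0 lt_neqAle eq_sym h.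
Qed.

Lemma netf_stale r m i x : ~~ fresh i -> netf r m i x = 0.
Proof. by rewrite /netf /net_bump => /negbTE ->; rewrite mul0r; case: ifP. Qed.

Lemma netf_peak r m i j : is_net r m -> (i <= m)%N -> (j <= m)%N -> fresh j ->
  netf r m i (y j) = (i == j)%:R.
Proof.
move=> g im jm fj.
have zero l : (l <= m)%N -> l != j -> net_bump r m l (y j) = 0.
  move=> lm lj; rewrite /net_bump; case: ifP => // fl.
  have jm' : (j < m.+1)%N by [].
  rewrite (bigD1 (Ordinal jm')) /=; last by rewrite fj eq_sym.
  by rewrite dist_xx mul0r mulr0.
rewrite /netf im; have [->|ij] := eqVneq i j; last by rewrite zero// mul0r.
have jm' : (j < m.+1)%N by [].
have := net_bump_sum_gt0 (y j) g; rewrite (bigD1 (Ordinal jm'))//= big1 ?addr0.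
  by move=> h; rewrite divff// gt_eqF.
move=> l lj; apply: zero; first exact: leq_ord.
by apply: contra lj => /eqP e; exact/eqP/val_inj.
Qed.

Lemma is_net_exists r : 0 < r -> exists M, forall m, (M <= m)%N -> is_net r m.
Proof.
move=> r0; have /compact_near_coveringP nc := cptX.
have : \forall m \near \oo, [set: X] `<=` (fun x => exists2 n, (n <= m)%N & d x (y n) < r).
  apply: nc => x _; have [n hn] := @y_dense x (r / 2) (ltac:(lra)).
  exists ([set z | d x z < r / 2], [set m | (n <= m)%N]) => /=.
    by split; [apply: nbhs_dist; lra|exact: nbhs_infty_ge].
  move=> [z m] /= [xz nm]; exists n => //.
  by have := dtri z x (y n); rewrite (dC z x); lra.
by move=> [M _ hM]; exists M => m /hM h; split => // x; exact: h.
Qed.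

Lemma netf_modulus r m e : is_net r m -> 0 < e -> exists2 s, 0 < s &
  forall x z, d x z < s -> \sum_(i < m.+1) `|netf r m i x - netf r m i z| <= e.
Proof.
move=> g e0.
have h N : exists2 s, 0 < s & forall i x z, (i < N)%N -> d x z < s ->
    `|netf r m i x - netf r m i z| < e / m.+1%:R.
  elim: N => [|N [s s0 hs]]; first by exists 1.
  have [t t0 ht] := uniformly_continuous_dist (@netf_cont r m N g)
    (divr_gt0 e0 (ltr0Sn R m)).
  exists (Num.min s t); first by rewrite lt_min s0.
  move=> i x z; rewrite ltnS leq_eqVlt lt_min => /orP[/eqP ->|iN] /andP[xs xt].
    exact: ht.
  exact: hs.
have [s s0 hs] := h m.+1; exists s => // x z xz.
apply: (@le_trans _ _ (\sum_(i < m.+1) e / m.+1%:R)).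
  by apply: ler_sum => i _; apply/ltW/hs.
by rewrite sumr_const card_ord -[leLHS]mulr_natr divfK// pnatr_eq0.
Qed.

(** The radius at stage k + 1 is chosen below the modulus of continuity of stage k: points in the
    support of one later function see almost the same earlier weights. *)
Lemma net_tower : exists (m : nat -> nat) (r : nat -> R),
  [/\ m 0%N = 0%N, forall k, (m k < m k.+1)%N, forall k, is_net (r k) (m k),
      forall k, r k.+1 <= 2^-1 ^+ k &
      forall k x z, d x z < r k.+1 -> \sum_(i < (m k).+1)
        `|netf (r k) (m k) i x - netf (r k) (m k) i z| <= 2^-1 ^+ k].
Proof.
have step (kp : nat * (R * nat)) : exists p' : R * nat, is_net kp.2.1 kp.2.2 ->
    [/\ (kp.2.2 < p'.2)%N, is_net p'.1 p'.2, p'.1 <= 2^-1 ^+ kp.1 &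
      forall x z, d x z < p'.1 -> \sum_(i < kp.2.2.+1)
        `|netf kp.2.1 kp.2.2 i x - netf kp.2.1 kp.2.2 i z| <= 2^-1 ^+ kp.1].
  case: kp => k [r m] /=.
  have [g|ng] := pselect (is_net r m); last by exists (0, 0%N) => /ng.
  have e0 : 0 < 2^-1 ^+ k :> R by rewrite exprn_gt0// invr_gt0.
  have [s s0 hs] := netf_modulus g e0.
  have m0 : 0 < Num.min s (2^-1 ^+ k) by rewrite lt_min s0.
  have [M hM] := is_net_exists m0.
  exists (Num.min s (2^-1 ^+ k), (maxn M m.+1)) => _ /=; split.
  - lia.
  - by apply: hM; lia.
  - by rewrite ge_min lexx orbT.
  - by move=> x z; rewrite lt_min => /andP[xs _]; exact: hs.
have [f hf] := choice step.
have [M M0 hM] := continuous_bounded (@continuous_dist (y 0%N)).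
(* [M + 1] exceeds every distance to [y 0], so that this single point is already a net. *)
pose st := fix st k := if k is k'.+1 then f (k', st k') else (M + 1, 0%N).
have gst k : is_net (st k).1 (st k).2.
  elim: k => [|k IH] /=; last by have [] := hf (k, st k) IH.
  split; first lra.
  by move=> x; exists 0%N => //; have := hM x; rewrite ler_norml; lra.
exists (fun k => (st k).2), (fun k => (st k).1); split => //.
all: by move=> k; have [] := hf (k, st k) (gst k).
Qed.

End nets.
End compact_metric.

(** * Harmonic extension along the nets *)

Section harmonic.
Variables (R : realType) (X : topologicalType) (d : X -> X -> R).
Hypothesis cptX : compact [set: X].
Hypothesis d0 : forall x y, d x y = 0 <-> x = y.
Hypothesis dC : forall x y, d x y = d y x.
Hypothesis dtri : forall x y z, d x z <= d x y + d y z.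
Hypothesis dnbhs : forall x, nbhs x =
  filter_from [set e : R | 0 < e] (fun e => [set y | d x y < e]).
Variable y : nat -> X.
Hypothesis y_dense : forall x (r : R), 0 < r -> exists n, d x (y n) < r.
Variables (m : nat -> nat) (r : nat -> R).
Hypothesis m0 : m 0%N = 0%N.
Hypothesis m_incr : forall k, (m k < m k.+1)%N.
Hypothesis netk : forall k, is_net d y (r k) (m k).
Hypothesis r_small : forall k, r k.+1 <= 2^-1 ^+ k.
Hypothesis r_osc : forall k x z, d x z < r k.+1 -> \sum_(i < (m k).+1)
  `|netf d y (r k) (m k) i x - netf d y (r k) (m k) i z| <= 2^-1 ^+ k.

Local Notation F k := (netf d y (r k) (m k)).
Local Notation eps k := (2^-1 ^+ k : R).

Lemma eps_gt0 k : 0 < eps k.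
Proof. by rewrite exprn_gt0// invr_gt0. Qed.

Lemma epsS k : eps k.+1 = eps k / 2.
Proof. by rewrite exprSr. Qed.

Lemma eps_small (e : R) : 0 < e -> exists K, forall k, (K <= k)%N -> eps k < e.
Proof.
move=> e0; have e2 : 0 < e / 2 by lra.
have [N hN] := pow_ge e2.
exists N => k Nk; rewrite exprVn invf_plt ?posrE ?exprn_gt0//.
have h : e^-1 < 2 ^+ N.
  rewrite -div1r ltr_pdivrMr//; move: hN.
  have : 0 < 2 ^+ N * e by rewrite mulr_gt0// exprn_gt0.
  by lra.
by apply: lt_le_trans h _; rewrite ler_eXn2l// ltr1n.
Qed.

Lemma m_ge k : (k <= m k)%N.
Proof. by elim: k => // k IH; apply: leq_ltn_trans IH (m_incr k). Qed.

Lemma m_mono k k' : (k <= k')%N -> (m k <= m k')%N.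
Proof.
elim: k' => [|k' IH]; first by rewrite leqn0 => /eqP ->.
by rewrite leq_eqVlt => /orP[/eqP ->//|]; have := m_incr k'; rewrite ltnS => ? /IH; lia.
Qed.

Let blk_ex j : exists k, (j <= m k.+1)%N.
Proof. by exists j; have := m_ge j.+1; lia. Qed.

(* the stage at which the [j]-th point enters the net *)
Definition blk j := ex_minn (blk_ex j).

Lemma blkP j : (0 < j)%N -> (m (blk j) < j <= m (blk j).+1)%N.
Proof.
rewrite /blk => j0; case: ex_minnP => -[|k] jk mi; first by rewrite m0 j0.
by rewrite jk andbT ltnNge; apply/negP => /mi; rewrite ltnn.
Qed.

Lemma blk_eq j k : (m k < j <= m k.+1)%N -> blk j = k.
Proof.
move=> /andP[kj jk]; have /andP[h1 h2] : (m (blk j) < j <= m (blk j).+1)%N.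
  by apply: blkP; lia.
apply/eqP; rewrite eqn_leq; apply/andP; split; rewrite leqNgt; apply/negP => h.
  by have := m_mono h; lia.
by have := m_mono h; lia.
Qed.

(** The weights that express the value at a new point through the last net preceding it; they become
    [wgt], in the role of a representing matrix of C(X). *)
Definition enter j l : R := F (blk j) l (y j).

Lemma enter_ge0 j l : 0 <= enter j l.
Proof. exact: netf_ge0. Qed.

Lemma enter_sumE j (b : nat -> R) : (0 < j)%N ->
  \sum_(l < j) enter j l * b l = \sum_(l < (m (blk j)).+1) F (blk j) l (y j) * b l.
Proof. by move=> /blkP/andP[h _]; rewrite /enter netf_sum_ext. Qed.

Lemma enter_sum j : (0 < j)%N -> \sum_(l < j) enter j l = 1.
Proof.
move=> j0; under eq_bigr do rewrite -[enter _ _]mulr1.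
rewrite (enter_sumE (fun=> 1) j0).
under eq_bigr do rewrite mulr1.
exact: netf_sum.
Qed.

Lemma dense_ge0 (g : X -> R) : continuous g ->
  (forall j, fresh y j -> 0 <= g (y j)) -> forall x, 0 <= g x.
Proof.
move=> /(continuous_distP dnbhs) cg gy x; rewrite leNgt; apply/negP => gx.
have [s s0 hs] := cg x (- g x) (ltac:(lra)).
have [n xn] := y_dense x s0; have [i [_ fi yi]] := fresh_rep y n.
have := hs (y n) xn; have := gy i fi; rewrite yi ltr_norml; lra.
Qed.

Lemma dense_eq (g h : X -> R) : continuous g -> continuous h ->
  (forall j, fresh y j -> g (y j) = h (y j)) -> forall x, g x = h x.
Proof.
move=> cg ch gh x; apply/eqP; rewrite eq_le; apply/andP; split; rewrite -subr_ge0.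
- apply: (@dense_ge0 (fun x => h x - g x)); first exact: continuousB2.
  by move=> j /gh ->; rewrite subrr.
- apply: (@dense_ge0 (fun x => g x - h x)); first exact: continuousB2.
  by move=> j /gh ->; rewrite subrr.
Qed.

(* The values at the points y j, j > n, that are forced by those at the points
   y j, j <= n, when every new value is interpolated at the stage of its entry. *)
Definition harmonic n (b : nat -> R) :=
  forall j, (n < j)%N -> b j = \sum_(l < j) enter j l * b l.

Section extension.
Variables (n : nat) (b : nat -> R) (C : R).
Hypotheses (bC : forall j, `|b j| <= C) (hb : harmonic n b).

Let G k x := \sum_(l < (m k).+1) F k l x * b l.

Let G_cont k : continuous (G k).
Proof.
rewrite /G; apply: continuous_sum2 => l.
by apply: continuousM2; [exact: netf_cont|exact: continuous_cst2].
Qed.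

(** At the points entering between stages k and k + 1 this is the harmonic condition itself: their
    values were defined by interpolation at stage k. *)
Let G_peak k j : (n <= m k)%N -> (j <= m k.+1)%N -> fresh y j -> G k (y j) = b j.
Proof.
move=> nk jk fj; have [jm|jm] := leqP j (m k).
  have jm' : (j < (m k).+1)%N by [].
  rewrite /G (bigD1 (Ordinal jm'))//= netf_peak// eqxx mul1r big1 ?addr0// => l lj.
  rewrite netf_peak//; last by rewrite -ltnS ltn_ord.
  by case: eqVneq => e; [case/eqP: lj; exact/val_inj|rewrite mul0r].
rewrite (hb (leq_ltn_trans nk jm)) enter_sumE; last by lia.
by rewrite (@blk_eq j k)// jm.
Qed.

(** By [G_peak], the next interpolation averages the values of [G k] at net points within [r k.+1]
    of x, where [r_osc] bounds the oscillation of [G k]. *)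
Let G_step k x : (n <= m k)%N -> `|G k.+1 x - G k x| <= C * eps k.
Proof.
move=> nk.
have C0 : 0 <= C by apply: le_trans (bC 0%N).
have -> : G k.+1 x - G k x =
    \sum_(j < (m k.+1).+1) F k.+1 j x * (G k (y j) - G k x).
  under [RHS]eq_bigr do rewrite mulrBr.
  rewrite sumrB -mulr_suml netf_sum// mul1r; congr (_ - _).
  apply: eq_bigr => j _; have [fj|sj] := boolP (fresh y j).
    by rewrite G_peak// -ltnS ltn_ord.
  by rewrite netf_stale// !mul0r.
apply: le_trans (ler_norm_sum _ _ _) _.
rewrite -[leRHS]mul1r -[X in _ <= X * _](netf_sum d0 dC dtri x (netk k.+1)) mulr_suml.
apply: ler_sum => j _; rewrite normrM ger0_norm ?netf_ge0//.
have [->|nz] := eqVneq (F k.+1 j x) 0; first by rewrite !mul0r.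
apply: ler_wpM2l; first exact: netf_ge0.
have := netf_supp (proj1 (netk k.+1)) nz => xj.
have osc := r_osc xj.
rewrite /G -sumrB; apply: le_trans (ler_norm_sum _ _ _) _.
rewrite [leRHS]mulrC; apply: le_trans _ (ler_wpM2r C0 osc).
rewrite mulr_suml; apply: ler_sum => l _.
by rewrite -mulrBl normrM distrC ler_wpM2l.
Qed.

(** [2 * C * eps k] is the sum of the step bounds [C * eps j] over j >= k, so the intervals from
    [lo] to [hi] are nested and enclose the limit. *)
Let lo k x := G k x - 2 * C * eps k.
Let hi k x := G k x + 2 * C * eps k.

Let lo_mono x k k' : (n <= m k)%N -> (k <= k')%N -> lo k x <= lo k' x.
Proof.
move=> nk; elim: k' => [|k' IH]; first by rewrite leqn0 => /eqP ->.
rewrite leq_eqVlt => /orP[/eqP ->//|]; rewrite ltnS => kk'.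
apply: le_trans (IH kk') _; rewrite /lo epsS.
by have := @G_step k' x (leq_trans nk (m_mono kk')); rewrite ler_norml; lra.
Qed.

Let hi_mono x k k' : (n <= m k)%N -> (k <= k')%N -> hi k' x <= hi k x.
Proof.
move=> nk; elim: k' => [|k' IH]; first by rewrite leqn0 => /eqP ->.
rewrite leq_eqVlt => /orP[/eqP ->//|]; rewrite ltnS => kk'.
apply: le_trans _ (IH kk'); rewrite /hi epsS.
by have := @G_step k' x (leq_trans nk (m_mono kk')); rewrite ler_norml; lra.
Qed.

Let lo_hi x k k' : (n <= m k)%N -> (n <= m k')%N -> lo k x <= hi k' x.
Proof.
have C0 : 0 <= C by apply: le_trans (bC 0%N).
move=> nk nk'; apply: (@le_trans _ _ (lo (maxn k k') x)); first by apply: lo_mono => //; lia.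
apply: (@le_trans _ _ (hi (maxn k k') x)); last by apply: hi_mono => //; lia.
by rewrite /lo /hi; have := mulr_ge0 C0 (ltW (eps_gt0 (maxn k k'))); lra.
Qed.

Lemma harmonic_extension : exists g : X -> R,
  [/\ continuous g, forall j, fresh y j -> g (y j) = b j &
      forall k x, (n <= m k)%N ->
        `|g x - \sum_(l < (m k).+1) F k l x * b l| <= 2 * C * eps k].
Proof.
pose A x : set R := [set lo k x | k in [set k | (n <= m k)%N]].
have An0 x : A x !=set0 by exists (lo n x); exists n => //=; exact: m_ge.
have lo_sup k x : (n <= m k)%N -> lo k x <= sup (A x).
  move=> nk; apply: ub_le_sup; last by exists k.
  by exists (hi k x) => _ [k' nk' <-]; exact: lo_hi.
have sup_hi k x : (n <= m k)%N -> sup (A x) <= hi k x.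
  by move=> nk; apply: ge_sup => // _ [k' nk' <-]; exact: lo_hi.
have close k x : (n <= m k)%N -> `|sup (A x) - G k x| <= 2 * C * eps k.
  move=> nk; have := lo_sup k x nk; have := sup_hi k x nk.
  by rewrite /lo /hi ler_norml; lra.
have C0 : 0 <= C by apply: le_trans (bC 0%N).
have small (e : R) : 0 < e -> exists K, forall k, (K <= k)%N ->
    (n <= m k)%N /\ 2 * C * eps k < e.
  move=> e0; have C2 : 0 < 2 * (C + 1) by lra.
  have [K hK] := eps_small (divr_gt0 e0 C2).
  exists (maxn n K) => k hk; split; first by apply: leq_trans (m_ge _); lia.
  have := hK k (ltac:(lia)); rewrite ltr_pdivlMr//.
  by have := eps_gt0 k; lra.
exists (fun x => sup (A x)); split => // [|j fj].
- apply/(continuous_distP dnbhs) => x e e0.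
  have [K hK] := small (e / 4) (ltac:(lra)); have [nk hk] := hK K (leqnn K).
  have /(continuous_distP dnbhs)/(_ x (e / 4) (ltac:(lra)))[s s0 hs] := @G_cont K.
  exists s => // z xz; have := hs z xz; have := close K x nk; have := close K z nk.
  by rewrite !ltr_norml !ler_norml; lra.
- apply/eqP; rewrite -subr_eq0 -normr_le0 leNgt; apply/negP => h.
  have [K hK] := small _ h; have [nk hk] := hK (maxn K j) (leq_maxl _ _).
  have := close _ (y j) nk; rewrite G_peak//; last first.
    by apply: leq_trans (m_ge _); lia.
  by rewrite leNgt hk.
Qed.

End extension.

(** The harmonic sequence that starts as a Kronecker delta on the indices up to n: the values at all
    points [y j] of the future function [pou n i]. *)
Lemma basis_exists n i : exists b : nat -> R,
  (fun j => if (j <= n)%N then (i == j)%:R else \sum_(l < j) enter j l * b l) = b.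
Proof.
apply: (@causal_fixpoint_exists R 0 nat id
  (fun b j => if (j <= n)%N then (i == j)%:R else \sum_(l < j) enter j l * b l)).
move=> b b' j bb'; case: ifP => // _; apply: eq_bigr => l _.
by rewrite bb'//= ltn_ord.
Qed.

Definition basis n i : nat -> R := sval (cid (basis_exists n i)).

Lemma basisE n i j : basis n i j =
  if (j <= n)%N then (i == j)%:R else \sum_(l < j) enter j l * basis n i l.
Proof. by rewrite /basis; case: cid => b /= {1}<-. Qed.

Lemma basis_harmonic n i : harmonic n (basis n i).
Proof. by move=> j nj; rewrite basisE leqNgt nj. Qed.

Lemma basis_ge0 n i j : 0 <= basis n i j.
Proof.
have [N] := ubnP j; elim: N j => // N IH j jN; rewrite basisE; case: ifP => // _.
by apply: sumr_ge0 => l _; rewrite mulr_ge0 ?enter_ge0// IH//; have := ltn_ord l; lia.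
Qed.

Lemma basis_sum n j : \sum_(i < n.+1) basis n i j = 1.
Proof.
have [N] := ubnP j; elim: N j => // N IH j jN.
under eq_bigr do rewrite basisE.
have [jn|jn] := leqP j n.
  have jn' : (j < n.+1)%N by [].
  rewrite (bigD1 (Ordinal jn'))//= eqxx big1 ?addr0// => l lj.
  by case: eqVneq => // e; case/eqP: lj; exact/val_inj.
rewrite exchange_big /= -[RHS](@enter_sum j); last lia.
apply: eq_bigr => l _; rewrite -mulr_sumr IH ?mulr1//.
by have := ltn_ord l; lia.
Qed.

(** Both sides satisfy the same recursion beyond n + 1 and agree before it; at n + 1, interpolating
    a delta returns its coefficient [enter n.+1 i]. *)
Lemma basis_refine n i j : (i <= n)%N ->
  basis n i j = basis n.+1 i j + enter n.+1 i * basis n.+1 n.+1 j.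
Proof.
move=> iN; have [N] := ubnP j; elim: N j => // N IH j jN.
rewrite (basisE n) (basisE n.+1 i) (basisE n.+1 n.+1).
have [jn|jn] := leqP j n.
  rewrite (leqW jn) (_ : (n.+1 == j) = false) ?mulr0 ?addr0//; lia.
have [jn1|jn1] := leqP j n.+1.
  have -> : j = n.+1 by lia.
  rewrite eqxx mulr1 (_ : (i == n.+1) = false) ?add0r; last lia.
  have iN' : (i < n.+1)%N by [].
  rewrite (bigD1 (Ordinal iN'))//= basisE iN eqxx mulr1 big1 ?addr0// => l li.
  rewrite basisE -ltnS ltn_ord.
  by case: eqVneq => e; rewrite ?mulr0//; case/eqP: li; exact/val_inj.
rewrite mulr_sumr -big_split /=; apply: eq_bigr => l _.
by rewrite IH; [ring|have := ltn_ord l; lia].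
Qed.

(** A repeated point enters every later interpolation with weight 0, so the value 1 at its own index
    never spreads. *)
Lemma basis_dead n j : ~~ fresh y n -> j != n -> basis n n j = 0.
Proof.
move=> sn; have [N] := ubnP j; elim: N j => // N IH j jN jn.
rewrite basisE eq_sym (negbTE jn); case: ifP => // _; apply: big1 => l _.
have [->|ln] := eqVneq (l : nat) n; first by rewrite /enter netf_stale// mul0r.
by rewrite IH ?mulr0//; have := ltn_ord l; lia.
Qed.

Lemma basis_le1 n i j : (i <= n)%N -> `|basis n i j| <= 1.
Proof.
move=> iN; rewrite ger0_norm ?basis_ge0// -(basis_sum n j).
have iN' : (i < n.+1)%N by [].
rewrite (bigD1 (Ordinal iN'))//= lerDl.
by apply: sumr_ge0 => l _; exact: basis_ge0.
Qed.

Lemma peaked_system_of_nets : y 0%N <> y 1%N -> inhabited (peaked_system R X).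
Proof.
move=> y01.
have /choice[e he] (ni : nat * nat) : exists g : X -> R, continuous g /\
    ((ni.2 <= ni.1)%N -> forall j, fresh y j -> g (y j) = basis ni.1 ni.2 j).
  case: ni => n i /=; have [iN|_] := leqP i n; last first.
    by exists (fun=> 0); split => //; exact: continuous_cst2.
  have [g [cg gy _]] := harmonic_extension (fun j => basis_le1 j iN) (@basis_harmonic n i).
  by exists g.
pose p n i x := if (i <= n)%N then e (n, i) x else 0.
have pE n i x : (i <= n)%N -> p n i x = e (n, i) x by rewrite /p => ->.
have py n i j : (i <= n)%N -> fresh y j -> p n i (y j) = basis n i j.
  by move=> iN fj; rewrite pE//; have [_] := he (n, i); apply.
have cp n i : continuous (p n i).
  rewrite /p; case: (i <= n)%N; last exact: continuous_cst2.
  by have [] := he (n, i).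
have p_sum n x : \sum_(i < n.+1) p n i x = 1.
  apply: (dense_eq (g := fun x => \sum_(i < n.+1) p n i x) (h := fun=> 1)).
  - by apply: continuous_sum2.
  - exact: continuous_cst2.
  - move=> j fj; rewrite -[RHS](basis_sum n j); apply: eq_bigr => i _.
    by rewrite py// -ltnS ltn_ord.
constructor; refine (@PeakedSystem R X y (fresh y) enter p _ _ _ cp _ p_sum _ _ _ _).
- by apply/asboolP => -[].
- exact: enter_ge0.
- by move=> n; exact: enter_sum.
- move=> n i x; have [iN|iN] := leqP i n; last by rewrite /p leqNgt iN.
  apply: (dense_ge0 (g := p n i)) => // j fj; rewrite py//; exact: basis_ge0.
- move=> n i x iN.
  apply: (dense_eq (g := p n i) (h := fun x => p n.+1 i x + enter n.+1 i * p n.+1 n.+1 x)).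
  + exact: cp.
  + by apply: continuousD2 => //; apply: continuousM2 => //; exact: continuous_cst2.
  + by move=> j fj; rewrite !py ?(leqW iN)//; exact: basis_refine.
- move=> n x sn; apply: (dense_eq (g := p n n) (h := fun=> 0)) => //.
    exact: continuous_cst2.
  move=> j fj; rewrite py// basis_dead//.
  by apply: contra sn => /eqP <-.
- by move=> n i j iN jN fj; rewrite py// basisE jN.
- move=> phi cphi ep ep0.
  have [M M0 hM] := continuous_bounded cptX dnbhs cphi.
  have ep2 : 0 < ep / 2 by lra.
  have [s s0 hs] := uniformly_continuous_dist cptX dtri dnbhs cphi ep2.
  have [K1 hK1] := eps_small s0.
  have M2 : 0 < 2 * M by lra.
  have [K2 hK2] := eps_small (divr_gt0 ep2 M2).
  (* The successor is needed because [r_small] bounds the radius at [k.+1] by [eps k]. *)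
  pose k := (maxn K1 K2).+1.
  exists (m k), (fun i => phi (y i)) => x.
  (* The combination of the [p (m k) i] with coefficients [phi (y i)] is the harmonic extension of
     b. It is compared with [phi] through the interpolation at stage k, which is close to both. *)
  pose b j := \sum_(i < (m k).+1) phi (y i) * basis (m k) i j.
  have bM j : `|b j| <= M.
    apply: le_trans (ler_norm_sum _ _ _) _.
    rewrite -[leRHS]mulr1 -(basis_sum (m k) j) mulr_sumr; apply: ler_sum => i _.
    by rewrite normrM (ger0_norm (basis_ge0 _ _ _)) ler_wpM2r ?basis_ge0.
  have bh : harmonic (m k) b.
    move=> j kj; rewrite /b; under [RHS]eq_bigr do rewrite mulr_sumr.
    rewrite exchange_big /=; apply: eq_bigr => i _; rewrite basis_harmonic// mulr_sumr.
    by apply: eq_bigr => l _; ring.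
  have bphi l : (l <= m k)%N -> b l = phi (y l).
    move=> lk; have lk' : (l < (m k).+1)%N by [].
    rewrite /b (bigD1 (Ordinal lk'))//= basisE lk eqxx mulr1 big1 ?addr0// => i il.
    by rewrite basisE lk; case: eqVneq => h; rewrite ?mulr0//; case/eqP: il; exact/val_inj.
  have [g [cg gy gG]] := harmonic_extension bM bh.
  have -> : \sum_(i < (m k).+1) phi (y i) * p (m k) i x = g x.
    apply: (dense_eq (g := fun x => \sum_(i < (m k).+1) phi (y i) * p (m k) i x)) => //.
      apply: continuous_sum2 => i.
      by apply: continuousM2 => //; exact: continuous_cst2.
    move=> j fj; rewrite gy//; apply: eq_bigr => i _.
    by rewrite py// -ltnS ltn_ord.
  have h1 := gG k x (leqnn _).
  have h2 : `|phi x - \sum_(l < (m k).+1) F k l x * b l| <= ep / 2.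
    rewrite -[phi x]mul1r -[X in X * phi x](netf_sum d0 dC dtri x (netk k)) mulr_suml -sumrB.
    apply: le_trans (ler_norm_sum _ _ _) _.
    rewrite -[leRHS]mul1r -[X in _ <= X * _](netf_sum d0 dC dtri x (netk k)) mulr_suml.
    apply: ler_sum => l _; rewrite (bphi l (leq_ord l)).
    rewrite -mulrBr normrM ger0_norm ?netf_ge0//.
    have [->|nz] := eqVneq (F k l x) 0; first by rewrite !mul0r.
    apply: ler_wpM2l; first exact: netf_ge0.
    apply/ltW/hs/(lt_le_trans (netf_supp (proj1 (netk k)) nz)).
    by apply: le_trans (r_small _) (ltW (hK1 _ (leq_maxl _ _))).
  have h3 : 2 * M * eps k <= ep / 2.
    have := hK2 k (leqW (leq_maxr _ _)); rewrite ltr_pdivlMr; lra.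
  by move: h1 h2; rewrite !ler_norml; lra.
Qed.

End harmonic.

Lemma peaked_system_exists (R : realType) (X : topologicalType) :
  compact [set: X] -> metrizable R X -> (exists x y : X, x <> y) ->
  inhabited (peaked_system R X).
Proof.
move=> cptX [d [d0 dC dtri dnbhs]] [p [q pq]].
have [y [y0 y1 yd]] := dense_sequence cptX dC dnbhs p q.
have [m [r [m0 mi mg rs ro]]] := net_tower cptX d0 dC dtri dnbhs yd.
by apply: (peaked_system_of_nets cptX d0 dC dtri dnbhs yd m0 mi mg rs ro); rewrite y0 y1.
Qed.

(** * The tower of averages *)

(** Depth and number of functions grow together: a cell of depth n is tested by [pou n].
    [(k, D, None)] holds the average of the newest function over the cell D, and [(k, D, Some i)], i
    < size D, the average of the i-th function over its left half; the last average follows from the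
    sum 1. *)
Notation address := (nat * seq bool * option nat)%type.

Section coordinates.
Variables (R : realType) (X : topologicalType) (S : peaked_system R X).
Local Notation a := (wgt S).
Local Notation e := (pou S).

Implicit Types (x y : address -> R) (c : address) (D : seq bool) (k l i j : nat).

(* With [mass x k D] the averages of the functions [e (size D)] over the cell
   D, [child_mass x _ k b D] are their averages over the child b of D. *)
Definition child_mass x (p : nat -> R) k b D i : R :=
  let f := if (i < size D)%N then x (k, D, Some i)
           else 1 - \sum_(j < size D) x (k, D, Some (j : nat)) in
  if b then 2 * p i - f else f.

(** By [pou_refine], the new vertex draws its mass from the old vertices in the proportions
    [wgt]. *)
Fixpoint mass x k D i : R :=
  if D is b :: D' then
    if (i <= size D')%N
    then child_mass x (mass x k D') k b D' i - x (k, D, None) * a (size D').+1 i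
    else if i == (size D').+1 then x (k, D, None) else 0
  else (i == 0%N)%:R.

(** A half has total mass 1, and no vertex has more there than twice its mass in the parent. The
    lower bound is what remains when all later vertices take their maximum. *)
Definition lo c x : R :=
  match c with
  | (k, D, Some i) => if (i < size D)%N then
      Num.max 0 (1 - \sum_(j < i) x (k, D, Some (j : nat)) -
                 \sum_(j < (size D).+1 | (i < j)%N) 2 * mass x k D j) else 0
  | _ => 0
  end.

(** A new vertex may grow until some old vertex is exhausted; the initial value of the minimum is 0
    for a dead vertex and 1 for a live one. *)
Definition hi c x : R :=
  let: (k, D, o) := c in
  if o is Some i then
    if (i < size D)%N then
      Num.min (2 * mass x k D i) (1 - \sum_(j < i) x (k, D, Some (j : nat))) else 0
  else if D is b :: D then
    \big[Num.min/(live S (size D).+1)%:R]_(i < (size D).+1 | 0 < a (size D).+1 i)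
      (child_mass x (mass x k D) k b D i / a (size D).+1 i)
  else 0.

Definition mid c x := (hi c x + lo c x) / 2.
Definition wid c x := (hi c x - lo c x) / 2.

Lemma midwidP c x : (`|x c - mid c x| <= wid c x) = (lo c x <= x c <= hi c x).
Proof.
by rewrite /mid /wid ler_norml; apply/idP/idP => /andP[? ?]; apply/andP; split; lra.
Qed.

(** The quadratic term leaves room for all [Some i], i < size D, between consecutive depths; the
    summand k lets the free coordinates reach arbitrarily high ranks. *)
Definition rank c : nat :=
  let: (k, D, o) := c in
  (k + size D * size D + size D + (if o is Some i then i.+1 else 0))%N.

(* the coordinates that [mass x k D] involves *)
Definition below k l c : bool :=
  let: (k', D, o) := c in (k' == k) &&
    (if o is Some i then (size D < l)%N && (i < size D)%N else (size D <= l)%N).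

Lemma below_rank k l D o i : below k l (k, D, o) -> (rank (k, D, o) <= k + l * l + l)%N.
Proof.
rewrite /= eqxx /=; case: o => [j /andP[Dl jD]|Dl]; last nia.
have : ((size D).+1 * (size D).+1 <= l * l)%N by apply: leq_mul.
by nia.
Qed.

Lemma eq_child_mass x y (p q : nat -> R) k b D i : p i = q i ->
  (forall j, (j < size D)%N -> x (k, D, Some j) = y (k, D, Some j)) ->
  child_mass x p k b D i = child_mass y q k b D i.
Proof.
move=> pq xy; rewrite /child_mass pq.
have -> : \sum_(j < size D) x (k, D, Some (j : nat)) =
          \sum_(j < size D) y (k, D, Some (j : nat)).
  by apply: eq_bigr => j _; exact: xy.
by have [/xy ->|] := ltnP i (size D).
Qed.

Lemma eq_mass x y k l D : (size D <= l)%N ->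
  (forall c, below k l c -> x c = y c) -> mass x k D =1 mass y k D.
Proof.
elim: D => [//|b D IH] Dl xy i /=.
have IH' := IH (ltnW Dl) xy.
rewrite (@eq_child_mass x y (mass x k D) (mass y k D)); last 2 first.
- exact: IH'.
- by move=> j jD; apply: xy; rewrite /= eqxx jD andbT.
by rewrite [x (k, b :: D, None)]xy//= eqxx.
Qed.

Lemma lo_causal c x y :
  (forall c', (rank c' < rank c)%N -> x c' = y c') -> lo c x = lo c y.
Proof.
case: c => [[k D] [i|//]] xy /=; case: ifP => // iD.
have em := @eq_mass x y k (size D) D (leqnn _).
have {em} em : mass x k D =1 mass y k D.
  apply: em => -[[k' D'] o] h; apply: xy.
  have kk : k' = k by case/andP: h => /eqP.
  by rewrite kk in h *; have := below_rank 0 h; rewrite /=; lia.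
congr (Num.max 0 (_ - _ - _)); apply: eq_bigr => j _; last by rewrite em.
by apply: xy => /=; rewrite ltn_add2l ltnS ltn_ord.
Qed.

Lemma hi_causal c x y :
  (forall c', (rank c' < rank c)%N -> x c' = y c') -> hi c x = hi c y.
Proof.
have em k D : (forall c', (rank c' < k + size D * size D + size D + 1)%N -> x c' = y c') ->
    mass x k D =1 mass y k D.
  move=> xy; apply: (@eq_mass x y k (size D) D (leqnn _)) => -[[k' D'] o] h; apply: xy.
  have kk : k' = k by case/andP: h => /eqP.
  by rewrite kk in h *; have := below_rank 0 h; rewrite /=; lia.
case: c => [[k D] [i|]] xy.
  have {}em : mass x k D =1 mass y k D.
    by apply: em => c' hc; apply: xy => /=; lia.
  rewrite /=; case: ifP => // iD; rewrite em.
  have -> // : \sum_(j < i) x (k, D, Some (j : nat)) = \sum_(j < i) y (k, D, Some (j : nat)).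
  by apply: eq_bigr => j _; apply: xy => /=; rewrite ltn_add2l ltnS ltn_ord.
case: D xy => [//|b D] xy; rewrite /=.
have {}em : mass x k D =1 mass y k D.
  by apply: em => c' hc; apply: xy => /=; nia.
apply: eq_bigr => i _; congr (_ / _); apply: eq_child_mass; first exact: em.
by move=> j jD; apply: xy => /=; nia.
Qed.

Lemma child_mass_cont k b D i (p : (address -> R) -> nat -> R) :
  cylindrical (p ^~ i) -> cylindrical (fun x => child_mass x (p x) k b D i).
Proof.
move=> cp Z x cx.
have cf : continuous (fun z => if (i < size D)%N then x z (k, D, Some i)
           else 1 - \sum_(j < size D) x z (k, D, Some (j : nat))).
  case: (i < size D)%N; first exact: cx.
  by apply: continuousB2; [exact: continuous_cst2|apply: continuous_sum2 => j; exact: cx].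
rewrite /child_mass; case: b => //; apply: continuousB2 => //.
by apply: continuousM2; [exact: continuous_cst2|exact: cp].
Qed.

Lemma mass_cont k D i : cylindrical (fun x => mass x k D i).
Proof.
elim: D i => [|b D IH] i Z x cx /=; first exact: continuous_cst2.
case: (i <= size D)%N; last first.
  by case: (i == _) => //; exact: continuous_cst2.
apply: continuousB2; last by apply: continuousM2; [exact: cx|exact: continuous_cst2].
by apply: (@child_mass_cont k b D i (fun x => mass x k D)).
Qed.

Lemma lo_cont c : cylindrical (lo c).
Proof.
case: c => [[k D] [i|]] Z x cx /=; last exact: continuous_cst2.
case: (i < size D)%N; last exact: continuous_cst2.
apply: continuous_max2; first exact: continuous_cst2.
apply: continuousB2.
  by apply: continuousB2; [exact: continuous_cst2|apply: continuous_sum2 => j; exact: cx].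
apply: continuous_sum2 => j; apply: continuousM2; first exact: continuous_cst2.
exact: mass_cont.
Qed.

Lemma hi_cont c : cylindrical (hi c).
Proof.
case: c => [[k D] [i|]] Z x cx.
  rewrite /=; case: (i < size D)%N; last exact: continuous_cst2.
  apply: continuous_min2.
    by apply: continuousM2; [exact: continuous_cst2|exact: mass_cont].
  by apply: continuousB2; [exact: continuous_cst2|apply: continuous_sum2 => j; exact: cx].
case: D => [|b D] /=; first exact: continuous_cst2.
elim: (index_enum _) => [|i r IH].
  by under eq_fun do rewrite big_nil; exact: continuous_cst2.
under eq_fun do rewrite big_cons.
case: (0 < a (size D).+1 i) => //; apply: continuous_min2 => //.
apply: continuousM2; last exact: continuous_cst2.
by apply: (@child_mass_cont k b D i (fun x => mass x k D)) => //; exact: mass_cont.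
Qed.

Definition in_range x c := lo c x <= x c <= hi c x.

Definition simplex n (p : nat -> R) :=
  [/\ forall i, (i <= n)%N -> 0 <= p i, \sum_(i < n.+1) p i = 1 &
      forall i, (i <= n)%N -> ~~ live S i -> p i = 0].

Section halves.
Variables (x : address -> R) (k : nat) (D : seq bool).
Hypothesis sD : simplex (size D) (mass x k D).

Let tail i := \sum_(j < (size D).+1 | (i < j)%N) 2 * mass x k D j.
Let head i := \sum_(j < i) x (k, D, Some (j : nat)).

Let tailS i : (i <= size D)%N ->
  \sum_(j < (size D).+1 | (i <= j)%N) 2 * mass x k D j = 2 * mass x k D i + tail i.
Proof.
move=> iD; have iD' : (i < (size D).+1)%N by [].
rewrite (bigD1 (Ordinal iD'))//=; congr (_ + _); apply: eq_bigl => j.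
by rewrite -val_eqE /=; lia.
Qed.

Let tail_ge0 i : 0 <= tail i.
Proof.
have [h _ _] := sD; apply: sumr_ge0 => j _; rewrite mulr_ge0// h//.
by rewrite -ltnS ltn_ord.
Qed.

(* how much of the mass 1 of a child remains to be distributed *)
Lemma head_bound i : (i <= size D)%N ->
  (forall j, (j < i)%N -> in_range x (k, D, Some j)) ->
  head i <= 1 <= head i + 2 * mass x k D i + tail i.
Proof.
elim: i => [|i IH] iD okx.
  rewrite /head big_ord0 -addrA -tailS//= -mulr_sumr.
  by have [_ -> _] := sD; lra.
have := okx i (ltnSn i); rewrite /in_range /= iD ge_max le_min => /andP[/andP[_ h1] /andP[_ h2]].
have e1 : tail i = 2 * mass x k D i.+1 + tail i.+1 by rewrite -tailS.
have e2 : head i.+1 = head i + x (k, D, Some i) by rewrite /head big_ord_recr.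
by move: h1 h2; rewrite -/(head i) -/(tail i) e1 e2; lra.
Qed.

Lemma Some_bounds i :
  (forall j, (j < i)%N -> in_range x (k, D, Some j)) ->
  0 <= lo (k, D, Some i) x /\ lo (k, D, Some i) x <= hi (k, D, Some i) x <= 1.
Proof.
move=> okx; rewrite /=; have [iD|iD] := ltnP i (size D); last by split; lra.
have := head_bound (ltnW iD) okx; rewrite -/(head i) -/(tail i) => hb.
have m0 : 0 <= mass x k D i by have [h _ _] := sD; apply: h; exact: ltnW.
have h0 : 0 <= head i.
  apply: sumr_ge0 => j _; have := okx j (ltn_ord j).
  by rewrite /in_range /= (ltn_trans (ltn_ord j) iD) ge_max => /andP[/andP[]].
split; first by rewrite le_max lexx.
rewrite ge_max !le_min ge_min; have := tail_ge0 i.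
by move=> ?; apply/andP; split; [apply/andP; split; apply/andP; split; lra|apply/orP; right; lra].
Qed.

Hypothesis okx : forall j, (j < size D)%N -> in_range x (k, D, Some j).

Let f i := child_mass x (mass x k D) k false D i.

(** The last vertex takes whatever is left; [head_bound] at [size D], where the tail is empty, puts
    this between 0 and twice its mass. *)
Let f_bounds i : (i <= size D)%N -> 0 <= f i <= 2 * mass x k D i.
Proof.
rewrite /f /child_mass leq_eqVlt => /orP[/eqP ->|iD]; last first.
  rewrite iD; have := okx iD; rewrite /in_range /= iD ge_max le_min; lra.
rewrite ltnn -/(head (size D)).
have := @head_bound (size D) (leqnn _) okx.
have -> : tail (size D) = 0.
  by apply: big1 => j; have := ltn_ord j; rewrite ltnS leqNgt => /negbTE ->.
lra.
Qed.

Let f_sum : \sum_(i < (size D).+1) f i = 1.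
Proof.
rewrite big_ord_recr /= /f /child_mass ltnn.
under eq_bigr do rewrite ltn_ord.
by rewrite addrC subrK.
Qed.

Lemma child_mass_simplex b : simplex (size D) (child_mass x (mass x k D) k b D).
Proof.
have E i : child_mass x (mass x k D) k b D i = if b then 2 * mass x k D i - f i else f i by [].
have [h1 h2 h3] := sD.
split=> [i iD||i iD di].
- by rewrite E; have := f_bounds iD; case: (b); lra.
- under eq_bigr do rewrite E; case: (b); last exact: f_sum.
  by rewrite sumrB -mulr_sumr h2 f_sum; lra.
- by rewrite E; have := f_bounds iD; rewrite h3//; case: (b); lra.
Qed.

End halves.

Lemma bigmin_le (I : finType) (P : pred I) (F : I -> R) v u :
  (u <= \big[Num.min/v]_(t | P t) F t) <-> (u <= v /\ forall t, P t -> u <= F t).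
Proof.
split=> [h|[uv h]]; last first.
  by elim/big_rec : _ => [|t s Pt us]; rewrite ?le_min ?us ?h.
suff [h1 h2] : \big[Num.min/v]_(t | P t) F t <= v /\
    forall t, P t -> \big[Num.min/v]_(t | P t) F t <= F t.
  by split=> [|t Pt]; [exact: le_trans h1|exact: le_trans h (h2 t Pt)].
split; first by elim/big_rec : _ => // t s _; apply: le_trans; rewrite ge_min lexx orbT.
by move=> t Pt; rewrite (bigD1 t)//= ge_min lexx.
Qed.

Lemma hi_NoneP x k b D u : 0 <= u ->
  (u <= hi (k, b :: D, None) x) <-> (u <= (live S (size D).+1)%:R /\
    forall i, (i <= size D)%N -> u * a (size D).+1 i <= child_mass x (mass x k D) k b D i
      \/ a (size D).+1 i = 0).
Proof.
move=> u0; rewrite /= bigmin_le; split=> -[h1 h2]; split=> // i.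
  rewrite -ltnS => iD; have := wgt_ge0 S (size D).+1 i; rewrite le_eqVlt => /orP[/eqP <-|ai].
    by right.
  by left; rewrite -ler_pdivlMr//; exact: (h2 (Ordinal iD)).
move=> ai; rewrite ler_pdivlMr//; have [|//|h] := h2 i; first by rewrite -ltnS.
by move: ai; rewrite h ltxx.
Qed.

Lemma None_bounds x k b D : simplex (size D) (child_mass x (mass x k D) k b D) ->
  0 <= hi (k, b :: D, None) x <= 1.
Proof.
move=> [h _ _]; apply/andP; split.
  apply/hi_NoneP => //; split; first by rewrite ler0n.
  by move=> i iD; left; rewrite mul0r h.
have := lexx (hi (k, b :: D, None) x); have [h0|h0] := leP 0 (hi (k, b :: D, None) x).
  move=> /(hi_NoneP _ _ _ _ h0)[h1 _]; apply: le_trans h1 _.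
  by rewrite lern1 leq_b1.
lra.
Qed.

Lemma live0 : live S 0.
Proof.
apply/negPn/negP => h; have := pou_sum S 0 (pk S 0).
by rewrite big_ord_recl big_ord0 addr0 pou_dead// => /eqP; rewrite eq_sym oner_eq0.
Qed.

(** Bisection stays in the simplex by [child_mass_simplex]; the new vertex receives exactly what the
    old ones lose, as the weights sum to 1, and [hi] keeps each of them nonnegative. *)
Lemma mass_simplex x k l D : (size D <= l)%N ->
  (forall c, below k l c -> in_range x c) -> simplex (size D) (mass x k D).
Proof.
elim: D => [|b D IH] Dl okx.
  split=> [i _|/=|i].
  - by rewrite /= ler0n.
  - by rewrite big_ord_recl big_ord0 addr0.
  - by rewrite leqn0 => /eqP ->; rewrite live0.
have sD := IH (ltnW Dl) okx.
have okD j : (j < size D)%N -> in_range x (k, D, Some j).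
  by move=> jD; apply: okx; rewrite /= eqxx jD andbT.
have [h1 h2 h3] := child_mass_simplex sD okD b.
set V := child_mass _ _ _ _ _ in h1 h2 h3.
have okN : in_range x (k, b :: D, None) by apply: okx; rewrite /= eqxx.
set s := x (k, b :: D, None) in okN.
have s0 : 0 <= s by move: okN; rewrite /in_range /= => /andP[].
have [s1 sV] : s <= (live S (size D).+1)%:R /\
    forall i, (i <= size D)%N -> s * a (size D).+1 i <= V i \/ a (size D).+1 i = 0.
  by apply/hi_NoneP => //; move: okN; rewrite /in_range => /andP[].
have V0 i : (i <= size D)%N -> 0 <= V i - s * a (size D).+1 i <= V i.
  move=> iD; have := h1 i iD; have := mulr_ge0 s0 (wgt_ge0 S (size D).+1 i).
  by have [?|->] := sV i iD; rewrite ?mulr0; lra.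
split=> [i|/=|i] /=.
- rewrite leq_eqVlt => /orP[/eqP ->|]; first by rewrite ltnn eqxx.
  by rewrite ltnS => iD; rewrite iD; have /andP[] := V0 i iD.
- rewrite big_ord_recr /= ltnn eqxx.
  under eq_bigr => i _ do rewrite -ltnS ltn_ord.
  by rewrite sumrB -mulr_sumr wgt_sum h2 mulr1 subrK.
- rewrite leq_eqVlt => /orP[/eqP ->|].
    rewrite ltnn eqxx => /negbTE di; have {}s1 : s <= 0 by rewrite di in s1.
    by rewrite -/s; lra.
  rewrite ltnS => iD di; rewrite iD; have := V0 i iD; have := h3 i iD di; rewrite -/V -/s; lra.
Qed.

Lemma wid_bounds c x : (forall c', (rank c' < rank c)%N -> in_range x c') ->
  0 <= lo c x /\ lo c x <= hi c x <= 1.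
Proof.
case: c => [[k D] o] okx.
have below_ok l c' : (k + l * l + l < rank (k, D, o))%N -> below k l c' -> in_range x c'.
  move: c' => [[k' D'] o'] h bl; apply: okx.
  have kk : k' = k by case/andP: bl => /eqP.
  rewrite kk in bl *; have := below_rank 0 bl; lia.
case: o okx below_ok => [i|] okx below_ok.
  have [iD|iD] := ltnP i (size D); last by rewrite /= ltnNge iD /=; split; lra.
  apply: Some_bounds.
    by apply: (@mass_simplex _ _ (size D)) => // c'; apply: below_ok => /=; lia.
  by move=> j ji; apply: okx => /=; lia.
case: D okx below_ok => [|b D] okx below_ok; first by split => /=; lra.
split; first by rewrite /= lexx.
apply: None_bounds; apply: child_mass_simplex.
  by apply: (@mass_simplex _ _ (size D)) => // c'; apply: below_ok => /=; nia.
by move=> j jD; apply: okx => /=; nia.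
Qed.

Definition free_index j : address := (j, [:: false], None).

(** Before this coordinate all the mass of the half cell sits at vertex 0. Vertex 1 is live and
    draws from vertex 0 with weight 1, so it may take any share. *)
Lemma free_bounds j x : lo (free_index j) x = 0 /\ hi (free_index j) x = 1.
Proof.
have h1 : 1 <= hi (free_index j) x.
  apply/hi_NoneP => //; split; first by rewrite live1.
  move=> i; rewrite leqn0 => /eqP ->; left.
  have := wgt_sum S 0; rewrite big_ord_recl big_ord0 addr0 => ->.
  by rewrite /child_mass /= big_ord0 subr0 mulr1.
split=> //; apply/eqP; rewrite eq_le h1 andbT.
have := lexx (hi (free_index j) x).
by move=> /(hi_NoneP _ _ _ _ (le_trans ler01 h1))[]; rewrite live1.
Qed.

Lemma free_inj : injective free_index.
Proof. by move=> i j [->]. Qed.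

(** The power of 2 makes the index exceed the rank of c; the odd cofactor, which encodes the pair,
    keeps the product injective. *)
Definition code_index c n : nat := 
  (2 ^ rank c * (@pickle (address * nat)%type (c, n)).*2.+1)%N.

Lemma code_index_inj c n c' n' : code_index c n = code_index c' n' -> c = c' /\ n = n'.
Proof.
have h s t s' t' : (2 ^ s * t.*2.+1 = 2 ^ s' * t'.*2.+1 -> t = t')%N.
  elim: s s' => [|s IH] [|s'] /=.
  - by rewrite !mul1n => -[]; lia.
  - by rewrite mul1n expnS -mulnA; lia.
  - by rewrite mul1n expnS -mulnA; lia.
  - by rewrite !expnS -!mulnA => ?; apply: (IH s'); lia.
by move=> /h /(pcan_inj (@pickleK _)) [-> ->].
Qed.

Lemma code_index_rank c n : (rank c <= rank (free_index (code_index c n)))%N.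
Proof.
rewrite /= /code_index; have := ltn_expl (rank c) (ltnSn 1).
move: (2 ^ rank c)%N (pickle _) => p q; nia.
Qed.

Definition in_tower x := forall c, in_range x c.

Lemma coordinates_cube : exists H : (address -> R) -> nat -> R,
  [/\ forall j, cylindrical (H ^~ j),
      forall x, in_tower x -> forall j, `|H x j| <= 1,
      forall x y, in_tower x -> in_tower y -> H x = H y -> x = y &
      forall u, (forall j, `|u j| <= 1) -> exists2 x, in_tower x & H x = u].
Proof.
have tE x : tower mid wid x <-> in_tower x.
  by split=> h c; have := h c; rewrite /in_range midwidP.
have mc c : cylindrical (mid c).
  move=> Z x cx; apply: continuousM2; last exact: continuous_cst2.
  by apply: continuousD2; [exact: hi_cont|exact: lo_cont].
have wc c : cylindrical (wid c).
  move=> Z x cx; apply: continuousM2; last exact: continuous_cst2.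
  by apply: continuousB2; [exact: hi_cont|exact: lo_cont].
have [|||||H [H1 H2 H3 H4]] := @tower_cube R address rank mid wid free_index code_index
  _ _ _ free_inj _ _ code_index_inj code_index_rank mc wc.
- by move=> c x y xy; rewrite /mid (hi_causal xy) (lo_causal xy).
- by move=> c x y xy; rewrite /wid (hi_causal xy) (lo_causal xy).
- move=> c x h; have [|h1 h2] := @wid_bounds c x.
    by move=> c' hc; have := h c' hc; rewrite midwidP.
  by rewrite /wid; lra.
- by move=> j x; rewrite /mid; have [-> ->] := free_bounds j x; rewrite addr0.
- by move=> j x; rewrite /wid; have [-> ->] := free_bounds j x; rewrite subr0.
exists H; split => //.
- by move=> x /tE; exact: H2.
- by move=> x y /tE Tx /tE Ty; exact: H3.
- by move=> u /H4[x /tE Tx Hx]; exists x.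
Qed.

End coordinates.

(** * Averages over cells *)

Section cells.
Variables (R : realType) (X : topologicalType) (S : peaked_system R X).
Local Notation a := (wgt S).
Local Notation e := (pou S).
Implicit Types (alpha beta : HM R X) (phi psi : X -> R) (D : seq bool).
Implicit Types (k l i j n : nat).

Definition len k D : R := 2^-1 ^+ k.+1 * 2^-1 ^+ size D.

(* The cells of the k-th copy are the dyadic subintervals of
   [1 - 2^-k, 1 - 2^-(k+1)[; the head of D is the last bisection. *)
Fixpoint lft k D : R :=
  if D is b :: D' then lft k D' + (if b then len k D' / 2 else 0)
  else 1 - 2^-1 ^+ k.

Definition rgt k D := lft k D + len k D.

Lemma len_gt0 k D : 0 < len k D.
Proof. by rewrite mulr_gt0// exprn_gt0// invr_gt0. Qed.

Lemma len_cons k b D : len k (b :: D) = len k D / 2.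
Proof. by rewrite /len /= (exprSr _ (size D)) mulrA. Qed.

Lemma rgt_nil k : rgt k [::] = 1 - 2^-1 ^+ k.+1.
Proof. by rewrite /rgt /len /= mulr1 exprSr; field. Qed.

Lemma lft_false k D : lft k (false :: D) = lft k D.
Proof. by rewrite /= addr0. Qed.

Lemma rgt_false k D : rgt k (false :: D) = lft k (true :: D).
Proof. by rewrite /rgt lft_false len_cons. Qed.

Lemma rgt_true k D : rgt k (true :: D) = rgt k D.
Proof. by rewrite /rgt len_cons /=; field. Qed.

Lemma cell_nest k D1 D : lft k D <= lft k (D1 ++ D) /\ rgt k (D1 ++ D) <= rgt k D.
Proof.
elim: D1 => [|b D1 [h1 h2]] //; rewrite cat_cons.
have := len_gt0 k (D1 ++ D); move: h1 h2.
by case: b; rewrite /rgt !len_cons /=; lra.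
Qed.

Lemma pow_half_bounds k : 0 < (2^-1 ^+ k : R) <= 1.
Proof.
rewrite exprn_gt0 ?invr_gt0//= exprn_ile1 ?invr_ge0//.
by rewrite invf_le1// ler1n.
Qed.

Lemma cell_bounds k D : [/\ 0 <= lft k D, lft k D < rgt k D & rgt k D <= 1].
Proof.
have [h1 h2] := cell_nest k D [::]; rewrite cats0 in h1 h2.
have := pow_half_bounds k; have := pow_half_bounds k.+1.
move: h1 h2; rewrite rgt_nil /=; have := len_gt0 k D; rewrite /rgt => ? ? ? ? ?.
by split; lra.
Qed.

Lemma cell_ge0 k D : 0 <= lft k D. Proof. by have [] := cell_bounds k D. Qed.
Lemma cell_le1 k D : rgt k D <= 1. Proof. by have [] := cell_bounds k D. Qed.
Lemma cell_lt k D : lft k D < rgt k D. Proof. by have [] := cell_bounds k D. Qed.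
Hint Resolve cell_ge0 cell_le1 cell_lt : core.

Definition cavg phi k D alpha := hm_avg phi (lft k D) (rgt k D) alpha.

Lemma cavgE phi k D alpha :
  hint phi (lft k D) (rgt k D) alpha = len k D * cavg phi k D alpha.
Proof.
have -> : len k D = rgt k D - lft k D by rewrite /rgt addrAC subrr add0r.
rewrite /cavg hm_avgE mulrA divff ?mul1r//.
by rewrite subr_eq0 gt_eqF.
Qed.

Lemma cavg_hint phi k D alpha :
  cavg phi k D alpha = (len k D)^-1 * hint phi (lft k D) (rgt k D) alpha.
Proof. by rewrite cavgE mulKf// gt_eqF// len_gt0. Qed.

Lemma cavg_split phi k D alpha :
  2 * cavg phi k D alpha = cavg phi k (false :: D) alpha + cavg phi k (true :: D) alpha.
Proof.
have h : hint phi (lft k D) (rgt k D) alpha =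
    hint phi (lft k (false :: D)) (rgt k (false :: D)) alpha +
    hint phi (lft k (true :: D)) (rgt k (true :: D)) alpha.
  rewrite rgt_false rgt_true lft_false -hintU//.
  - by rewrite -rgt_false -[in leLHS](lft_false k D) ltW.
  - by rewrite -(rgt_true k D) ltW.
apply: (@mulfI _ (len k D)); first by rewrite gt_eqF ?len_gt0.
rewrite mulrCA -cavgE h !cavgE !len_cons.
by move: (len k D) (cavg _ _ _ _) (cavg _ _ _ _) => L u v; field.
Qed.

Lemma eq_cavg phi psi k D alpha beta :
  (forall u, lft k D <= set_val u < rgt k D -> phi (alpha u) = psi (beta u)) ->
  cavg phi k D alpha = cavg psi k D beta.
Proof. by move=> h; rewrite !cavg_hint (@eq_hint _ _ phi psi alpha beta). Qed.

Lemma cavgD phi psi c k D alpha :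
  cavg (fun x => phi x + c * psi x) k D alpha =
  cavg phi k D alpha + c * cavg psi k D alpha.
Proof. by rewrite !cavg_hint hintD// hintZ//; ring. Qed.

Lemma cavg_cst v k D alpha : cavg (fun=> v) k D alpha = v.
Proof.
rewrite cavg_hint (@hint_cst _ _ _ _ _ _ v)// ?ltW//.
have -> : rgt k D - lft k D = len k D by rewrite /rgt addrAC subrr add0r.
by rewrite mulrCA mulVf ?mulr1// gt_eqF// len_gt0.
Qed.

Lemma cavg_ge0 phi k D alpha : (forall x, 0 <= phi x) -> 0 <= cavg phi k D alpha.
Proof.
move=> h; rewrite -(cavg_cst 0 k D alpha) !cavg_hint ler_wpM2l ?invr_ge0 ?(ltW (len_gt0 _ _))//.
by apply: le_hint.
Qed.

Lemma cavg_sum n k D alpha : \sum_(i < n.+1) cavg (e n i) k D alpha = 1.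
Proof.
rewrite -[RHS](cavg_cst 1 k D alpha).
rewrite (@eq_cavg (fun=> 1) (fun x => \sum_(i < n.+1) 1 * e n i x) _ _ alpha alpha); last first.
  by move=> u _; under eq_bigr do rewrite mul1r; rewrite pou_sum.
rewrite cavg_hint hint_sum//; last exact/ltW.
rewrite mulr_sumr.
by apply: eq_bigr => i _; rewrite mul1r cavg_hint.
Qed.

Lemma cavg_refine n i k D alpha : (i <= n)%N ->
  cavg (e n i) k D alpha =
  cavg (e n.+1 i) k D alpha + a n.+1 i * cavg (e n.+1 n.+1) k D alpha.
Proof.
by move=> iN; rewrite -cavgD; apply: eq_cavg => u _; exact: pou_refine.
Qed.

Definition coords alpha : address -> R := fun c =>
  match c with
  | (k, D, Some i) =>
      if (i < size D)%N then cavg (e (size D) i) k (false :: D) alpha else 0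
  | (k, D, None) =>
      if D is _ :: _ then cavg (e (size D) (size D)) k D alpha else 0
  end.

Lemma child_mass_coords alpha k b D i : (i <= size D)%N ->
  mass S (coords alpha) k D i = cavg (e (size D) i) k D alpha ->
  child_mass (coords alpha) (mass S (coords alpha) k D) k b D i =
  cavg (e (size D) i) k (b :: D) alpha.
Proof.
move=> iD hm.
have f : child_mass (coords alpha) (mass S (coords alpha) k D) k false D i =
    cavg (e (size D) i) k (false :: D) alpha.
  rewrite /child_mass; have [iD'|iD'] := ltnP i (size D); first by rewrite /= iD'.
  have -> : i = size D by apply/eqP; rewrite eqn_leq iD.
  rewrite -(cavg_sum (size D) k (false :: D) alpha) big_ord_recr /=.
  by under [X in _ - X]eq_bigr do rewrite ltn_ord; rewrite addrAC subrr add0r.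
case: b; last exact: f.
have g : forall u, child_mass (coords alpha) u k true D i =
    2 * u i - child_mass (coords alpha) u k false D i by [].
rewrite g f hm cavg_split.
by move: (cavg _ _ _ _) (cavg _ _ _ _) => u v; lra.
Qed.

(** The recursion of [mass] mirrors what averages do: [child_mass] accounts for the bisection,
    [cavg_refine] for the change of partition. *)
Lemma mass_coords alpha k D i : (i <= size D)%N ->
  mass S (coords alpha) k D i = cavg (e (size D) i) k D alpha.
Proof.
elim: D i => [|b D IH] i.
  rewrite leqn0 => /eqP -> /=.
  by have := cavg_sum 0 k [::] alpha; rewrite big_ord_recl big_ord0 addr0 => ->.
move=> iD; have [iD'|iD'] := leqP i (size D); last first.
  have -> : i = (size D).+1 by apply/eqP; rewrite eqn_leq iD.
  by rewrite /= ltnn eqxx.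
rewrite [LHS]/= iD' child_mass_coords ?IH// (@cavg_refine (size D) i k (b :: D))//=.
by rewrite mulrC addrK.
Qed.

Lemma coords_tower alpha : in_tower S (coords alpha).
Proof.
move=> [[k D] [i|]].
  rewrite /in_range /=; have [iD|iD] := ltnP i (size D); last by rewrite lexx.
  have sum1 := cavg_sum (size D) k (false :: D) alpha.
  pose h j := cavg (e (size D) j) k (false :: D) alpha.
  have h0 j : 0 <= h j by apply: cavg_ge0 => x; exact: pou_ge0.
  (* The average over the right half is nonnegative. *)
  have h2 j : (j <= size D)%N -> h j <= 2 * mass S (coords alpha) k D j.
    move=> jD; rewrite mass_coords// cavg_split lerDl.
    by apply: cavg_ge0 => x; exact: pou_ge0.
  have split_sum : 1 = \sum_(j < i) h j + h i + \sum_(j < (size D).+1 | (i < j)%N) h j.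
    rewrite -sum1 -(big_mkord xpredT h) (@big_cat_nat _ _ _ i)//=; last lia.
    rewrite big_mkord -addrA; congr (_ + _).
    rewrite big_ltn; last lia.
    congr (_ + _); rewrite -(big_mkord (fun j => (i < j)%N) h).
    rewrite (@big_cat_nat _ _ _ i.+1 0)//=; last lia.
    rewrite [X in _ = X + _]big1_seq ?add0r; last first.
      by move=> j /andP[ij]; rewrite mem_index_iota => ji; exfalso; lia.
    rewrite big_nat [RHS]big_nat_cond; apply: eq_bigl => j; lia.
  have -> : \sum_(j < i) (if (j < size D)%N then cavg (e (size D) j) k (false :: D) alpha else 0)
     = \sum_(j < i) h j.
    by apply: eq_bigr => j _; rewrite (ltn_trans (ltn_ord j) iD).
  have tl : \sum_(j < (size D).+1 | (i < j)%N) h j <=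
      \sum_(j < (size D).+1 | (i < j)%N) 2 * mass S (coords alpha) k D j.
    by apply: ler_sum => j _; apply: h2; rewrite -ltnS ltn_ord.
  have tl0 : 0 <= \sum_(j < (size D).+1 | (i < j)%N) h j by apply: sumr_ge0.
  rewrite ge_max le_min -/(h i) h0 h2 ?(ltnW iD)//=.
  by apply/andP; split; lra.
case: D => [|b D]; first by rewrite /in_range /= lexx.
have s0 : 0 <= coords alpha (k, b :: D, None).
  by apply: cavg_ge0 => x; exact: pou_ge0.
rewrite /in_range s0 /=; apply/hi_NoneP => //; split.
  have [lv|dv] := boolP (live S (size D).+1).
    have := cavg_sum (size D).+1 k (b :: D) alpha; rewrite big_ord_recr /= => <-.
    by rewrite lerDr; apply: sumr_ge0 => j _; apply: cavg_ge0 => x; exact: pou_ge0.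
  rewrite (@eq_cavg _ (fun=> 0) k (b :: D) alpha alpha) ?cavg_cst//.
  by move=> u _; exact: pou_dead.
(* What the old vertex i keeps is the average of a nonnegative function of the finer partition. *)
move=> i iD; left; rewrite child_mass_coords ?mass_coords// [leRHS]cavg_refine// [leLHS]mulrC /=.
rewrite lerDr; apply: cavg_ge0 => x; exact: pou_ge0.
Qed.

(** * Exact realisation of finitely many coordinates *)

Section density.
Variable x : address -> R.
Hypothesis Tx : in_tower S x.

Definition matches alpha k D :=
  forall i, (i <= size D)%N -> cavg (e (size D) i) k D alpha = mass S x k D i.

Lemma eq_matches alpha beta k D :
  (forall u, lft k D <= set_val u < rgt k D -> alpha u = beta u) ->
  matches alpha k D -> matches beta k D.
Proof. by move=> h m i iD; rewrite -m//; apply: eq_cavg => u /h ->. Qed.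

Lemma matches_child alpha k b D : matches alpha k (b :: D) ->
  coords alpha (k, b :: D, None) = x (k, b :: D, None) /\
  forall i, (i <= size D)%N ->
    cavg (e (size D) i) k (b :: D) alpha = child_mass x (mass S x k D) k b D i.
Proof.
move=> m; have s : coords alpha (k, b :: D, None) = x (k, b :: D, None).
  by have := m (size D).+1 (leqnn _); rewrite /= ltnn eqxx.
split=> // i iD; rewrite cavg_refine// (m i (leqW iD)) /= iD.
by move: s => /= ->; rewrite mulrC subrK.
Qed.

Lemma matches_parent alpha k D :
  matches alpha k (false :: D) -> matches alpha k (true :: D) ->
  matches alpha k D /\
  forall i, (i < size D)%N -> coords alpha (k, D, Some i) = x (k, D, Some i).
Proof.
move=> /matches_child[_ hf] /matches_child[_ ht]; split=> i iD.
  have g : child_mass x (mass S x k D) k true D i =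
      2 * mass S x k D i - child_mass x (mass S x k D) k false D i by [].
  have := cavg_split (e (size D) i) k D alpha; rewrite (hf i iD) (ht i iD) g.
  by move: (cavg _ _ _ _) (child_mass _ _ _ _ _ _) (mass _ _ _ _ _) => u v t; lra.
by rewrite /= iD (hf i (ltnW iD)) /child_mass iD.
Qed.

Lemma matches_coords alpha k L :
  (forall D, size D = L -> matches alpha k D) ->
  forall D, (size D <= L)%N ->
    [/\ matches alpha k D, coords alpha (k, D, None) = x (k, D, None) &
        forall i, (size D < L)%N -> coords alpha (k, D, Some i) = x (k, D, Some i)].
Proof.
move=> mL; have mall D : (size D <= L)%N -> matches alpha k D.
  move=> DL; have [n] := ubnP (L - size D); elim: n D DL => // n IH D DL nD.
  move: DL; rewrite leq_eqVlt => /orP[/eqP /mL //|DL].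
  have mb b : matches alpha k (b :: D) by apply: IH => /=; lia.
  by have [] := matches_parent (mb false) (mb true).
move=> D DL; split => [||i Dl]; first exact: mall.
  case: D DL => [_|b D DL]; last by have [] := matches_child (mall _ DL).
  by have := Tx (k, [::], None); rewrite /in_range /= -eq_le => /eqP.
have [iD|iD] := ltnP i (size D).
  by have [_ h] := @matches_parent alpha k D (mall (false :: D) Dl) (mall (true :: D) Dl); exact: h.
have := Tx (k, D, Some i); rewrite /in_range /= ltnNge iD /= -eq_le => /eqP; exact.
Qed.

(** The step function takes the value [pk S i] on consecutive intervals of lengths [q i]. *)
Lemma fill n (c : R) (q : nat -> R) : 0 <= c -> (forall i, (i < n)%N -> 0 <= q i) ->
  c + \sum_(i < n) q i <= 1 -> exists alpha, forall phi,
  hint phi c (c + \sum_(i < n) q i) alpha = \sum_(i < n) q i * phi (pk S i).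
Proof.
move=> c0; elim: n => [|n IH] q0 q1.
  have [al hal] := @HM_cst R X (pk S 0); exists al => phi.
  move: q1; rewrite !big_ord0 addr0 => c1.
  rewrite (@hint_cst _ _ _ _ _ _ (phi (pk S 0))) ?subrr ?mulr0 ?lexx//.
  by move=> u _; rewrite hal.
move: q1; rewrite big_ord_recr /= => q1.
have qn : 0 <= q n by exact: q0.
have s0 : 0 <= \sum_(i < n) q i by apply: sumr_ge0 => i _; apply: q0; exact: (leqW (ltn_ord i)).
have [al hal] := IH (fun i h => q0 i (leqW h)) (ltac:(lra)).
have [be hbe] := @HM_cst R X (pk S n).
have [ga [h1 h2]] := @HM_glue R X al be (c + \sum_(i < n) q i) (ltac:(lra)).
exists ga => phi; rewrite big_ord_recr /= addrA.
rewrite (@hintU _ _ _ _ c (c + \sum_(i < n) q i)); try lra.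
congr (_ + _).
  rewrite -hal; apply: eq_hint => //; first lra.
  by move=> u /andP[_ /h1 ->].
rewrite (@hint_cst _ _ _ _ _ _ (phi (pk S n))); try lra.
by move=> u /andP[/h2 -> _]; rewrite hbe.
Qed.

(** Peakedness turns the share of the cell spent at the i-th peak into the average of the i-th
    function; dead vertices, where peakedness may fail, have mass 0. *)
Lemma cell_fill k D : exists alpha, matches alpha k D.
Proof.
have [p0 p1 pd] := @mass_simplex _ _ S x k (size D) D (leqnn _) (fun c _ => Tx c).
have L0 := len_gt0 k D.
have sumE : \sum_(i < (size D).+1) len k D * mass S x k D i = len k D.
  by rewrite -mulr_sumr p1 mulr1.
have [| |al hal] := @fill (size D).+1 (lft k D) (fun i => len k D * mass S x k D i)
    (cell_ge0 k D).
- by move=> i iD; rewrite mulr_ge0 ?(ltW L0)// p0.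
- by rewrite sumE; exact: cell_le1.
exists al => i iD; rewrite cavg_hint /rgt -[in X in hint _ _ X _]sumE hal.
under eq_bigr do rewrite -mulrA.
rewrite -mulr_sumr mulKf ?gt_eqF//.
have iD' : (i < (size D).+1)%N by [].
have term j : (j <= size D)%N ->
    mass S x k D j * e (size D) i (pk S j) = mass S x k D j * (i == j)%:R.
  move=> jD; have [lj|dj] := boolP (live S j); first by rewrite pou_pk.
  by rewrite pd// !mul0r.
rewrite (bigD1 (Ordinal iD'))//= term// eqxx mulr1 big1 ?addr0// => j ji.
rewrite term ?leq_ord//; case: eqVneq => h; last by rewrite mulr0.
by case/eqP: ji; exact/val_inj.
Qed.

Lemma tree_fill n k D : exists alpha, forall D1, size D1 = n -> matches alpha k (D1 ++ D).
Proof.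
elim: n D => [|n IH] D.
  have [al hal] := cell_fill k D; exists al => D1 /size0nil ->; exact: hal.
have [al hal] := IH (false :: D).
have [be hbe] := IH (true :: D).
have [|ga [h1 h2]] := @HM_glue R X al be (lft k (true :: D)).
  by have [] := cell_bounds k (true :: D); lra.
(* The head of an address is the last bisection, so the first one below D is the last bit of
   [D1]. *)
exists ga => D1; case/lastP: D1 => // D2 b; rewrite size_rcons => -[sD2].
rewrite cat_rcons; case: b.
  have [n1 n2] := cell_nest k D2 (true :: D).
  apply: eq_matches (hbe _ sD2) => u /andP[hu _]; rewrite h2//.
  exact: le_trans hu.
have [n1 n2] := cell_nest k D2 (false :: D).
apply: eq_matches (hal _ sD2) => u /andP[_ hu]; rewrite h1//.
by rewrite -rgt_false; exact: lt_le_trans n2.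
Qed.

Lemma forest_fill N n : exists alpha, forall k D, (k < N)%N -> size D = n -> matches alpha k D.
Proof.
elim: N => [|N [al hal]].
  by have [al _] := @HM_cst R X (pk S 0); exists al.
have [be hbe] := tree_fill n N [::].
have [|ga [h1 h2]] := @HM_glue R X al be (lft N [::]).
  by have [] := cell_bounds N [::]; lra.
exists ga => k D; rewrite ltnS leq_eqVlt => /orP[/eqP ->|kN] sD.
  have [n1 n2] := cell_nest N D [::]; rewrite cats0 in n1.
  have := hbe _ sD; rewrite cats0; apply: eq_matches => u /andP[hu _]; rewrite h2//.
  exact: le_trans hu.
have [n1 n2] := cell_nest k D [::]; rewrite cats0 rgt_nil in n2.
apply: eq_matches (hal _ _ kN sD) => u /andP[_ hu]; rewrite h1//.
apply: lt_le_trans hu (le_trans n2 _); rewrite /= lerD2l lerN2.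
rewrite -(subnK kN) exprD ler_piMl ?exprn_ge0 ?invr_ge0//.
by have /andP[] := pow_half_bounds (N - k.+1).
Qed.

Lemma coords_dense (s : seq address) : exists alpha,
  forall c, c \in s -> coords alpha c = x c.
Proof.
have [N hN] : exists N, forall c, c \in s ->
    (c.1.1 < N)%N /\ (size c.1.2 < N)%N.
  elim: s => [|c s [N hN]]; first by exists 0%N.
  exists (maxn N (maxn c.1.1.+1 (size c.1.2).+1)) => c'; rewrite inE !leq_max.
  by move=> /orP[/eqP ->|/hN[-> ->]//]; rewrite !leqnn !orbT.
have [al hal] := forest_fill N N; exists al => -[[k D] o] /hN[/= kN DN].
have [_ h1 h2] := @matches_coords al k N (fun D' sD' => hal k D' kN sD') D (ltnW DN).
by case: o => [i|//]; exact: h2.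
Qed.

End density.
End cells.

(** * The completion *)

Section controlled.
Local Arguments coords : simpl never.
Variables (R : realType) (X : topologicalType) (S : peaked_system R X).
Local Notation e := (pou S).
Local Notation J := (coords S).
Implicit Types (psi chi : HM R X -> R) (phi : X -> R) (D : seq bool).
Hint Resolve cell_ge0 cell_le1 cell_lt : core.

(* uniform continuity for the uniformity generated by the coordinates *)
Definition controlled psi := forall eps : R, 0 < eps ->
  exists (s : seq address) (del : R), 0 < del /\ forall alpha beta,
    (forall c, c \in s -> `|J alpha c - J beta c| < del) ->
    `|psi alpha - psi beta| < eps.

Lemma eq_controlled psi chi : psi =1 chi -> controlled psi -> controlled chi.
Proof. by move=> /funext ->. Qed.

Lemma controlled_cst v : controlled (fun=> v).
Proof.
by move=> eps e0; exists [::], 1; split=> // al be _; rewrite subrr normr0.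
Qed.

Lemma controlled_coord (c : address) : controlled (fun alpha => J alpha c).
Proof.
move=> eps e0; exists [:: c], eps; split=> // al be h; apply: h.
by rewrite mem_head.
Qed.

Lemma controlledD psi chi : controlled psi -> controlled chi ->
  controlled (fun alpha => psi alpha + chi alpha).
Proof.
move=> h1 h2 eps e0.
have [s1 [d1 [d10 g1]]] := h1 (eps / 2) (ltac:(lra)).
have [s2 [d2 [d20 g2]]] := h2 (eps / 2) (ltac:(lra)).
exists (s1 ++ s2), (Num.min d1 d2); split; first by rewrite lt_min d10.
move=> al be h.
have {}g1 : `|psi al - psi be| < eps / 2.
  apply: g1 => c cs; have := h c; rewrite mem_cat cs lt_min => /(_ isT) /andP[] //.
have {}g2 : `|chi al - chi be| < eps / 2.
  by apply: g2 => c cs; have := h c; rewrite mem_cat cs orbT lt_min => /(_ isT) /andP[].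
by move: g1 g2; rewrite !ltr_norml; lra.
Qed.

Lemma controlledZ v psi : controlled psi -> controlled (fun alpha => v * psi alpha).
Proof.
move=> h eps e0; have v1 : 0 < `|v| + 1 by rewrite ltr_wpDl.
have [s [d [d0 g]]] := h (eps / (`|v| + 1)) (divr_gt0 e0 v1).
exists s, d; split=> // al be hh; rewrite -mulrBr normrM.
have := g al be hh; rewrite ltr_pdivlMr//; apply: le_lt_trans.
by rewrite mulrC ler_wpM2l// lerDl.
Qed.

Lemma controlledB psi chi : controlled psi -> controlled chi ->
  controlled (fun alpha => psi alpha - chi alpha).
Proof.
move=> h1 h2; apply: (@eq_controlled (fun alpha => psi alpha + -1 * chi alpha)).
  by move=> al; rewrite mulN1r.
by apply: controlledD => //; exact: controlledZ.
Qed.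

Lemma controlled_sum (I : Type) (r : seq I) (P : pred I) (F : I -> HM R X -> R) :
  (forall i, P i -> controlled (F i)) -> controlled (fun alpha => \sum_(i <- r | P i) F i alpha).
Proof.
move=> hF; elim: r => [|i r IH].
  by under eq_fun do rewrite big_nil; exact: controlled_cst.
under eq_fun do rewrite big_cons.
by case Pi : (P i) => //; apply: controlledD => //; exact: hF.
Qed.

Lemma controlled_lim psi : (forall eps, 0 < eps ->
    exists2 chi, controlled chi & forall alpha, `|psi alpha - chi alpha| <= eps) ->
  controlled psi.
Proof.
move=> h eps e0; have [chi cchi hchi] := h (eps / 4) (ltac:(lra)).
have [s [d [d0 g]]] := cchi (eps / 4) (ltac:(lra)).
exists s, d; split=> // al be /g; have := hchi al; have := hchi be.
by rewrite !ler_norml !ltr_norml; lra.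
Qed.

Lemma controlled_child_mass k b D i (p : HM R X -> nat -> R) :
  controlled (p ^~ i) -> controlled (fun alpha => child_mass (J alpha) (p alpha) k b D i).
Proof.
move=> cp.
have cf : controlled (fun alpha => if (i < size D)%N then J alpha (k, D, Some i)
           else 1 - \sum_(j < size D) J alpha (k, D, Some (j : nat))).
  case: (i < size D)%N; first exact: controlled_coord.
  apply: controlledB; first exact: controlled_cst.
  by apply: controlled_sum => j _; exact: controlled_coord.
rewrite /child_mass; case: b; last exact: cf.
by apply: controlledB; [exact: controlledZ|exact: cf].
Qed.

Lemma controlled_mass k D i : controlled (fun alpha => mass S (J alpha) k D i).
Proof.
elim: D i => [|b D IH] i /=; first exact: controlled_cst.
case: (i <= size D)%N; last first.
  by case: (i == _); [exact: controlled_coord|exact: controlled_cst].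
apply: controlledB.
  by apply: (@controlled_child_mass k b D i (fun alpha => mass S (J alpha) k D)).
apply: (@eq_controlled (fun alpha => wgt S (size D).+1 i * J alpha (k, b :: D, None))).
  by move=> al; rewrite mulrC.
by apply: controlledZ; exact: controlled_coord.
Qed.

(** If the cell is at least n deep, the function is refined until its level equals the depth, where
    [mass] determines the average; a shallower cell is bisected first. *)
Lemma controlled_cavg n i k D : (i <= n)%N -> controlled (cavg (e n i) k D).
Proof.
have fine n' i' D' : (i' <= n')%N -> (n' <= size D')%N -> controlled (cavg (e n' i') k D').
  have [N] := ubnP (size D' - n')%N; elim: N n' i' => // N IH n' i' nN i'n.
  rewrite leq_eqVlt => /orP[/eqP n'D|n'D].
    apply: eq_controlled (controlled_mass k D' i') => al.
    by rewrite mass_coords -?n'D.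
  apply: (@eq_controlled (fun al => cavg (e n'.+1 i') k D' al +
      wgt S n'.+1 i' * cavg (e n'.+1 n'.+1) k D' al)).
    by move=> al; rewrite [RHS]cavg_refine.
  apply: controlledD; first by apply: IH => //; lia.
  by apply: controlledZ; apply: IH => //; lia.
move=> iN; have [N] := ubnP (n - size D)%N; elim: N D => // N IH D nN.
have [nD|Dn] := leqP n (size D); first exact: fine.
apply: (@eq_controlled (fun al => 2^-1 *
    (cavg (e n i) k (false :: D) al + cavg (e n i) k (true :: D) al))).
  by move=> al; rewrite -cavg_split mulKf// pnatr_eq0.
by apply: controlledZ; apply: controlledD; apply: IH => /=; lia.
Qed.

Lemma hint0 phi (a : R) alpha : 0 <= a <= 1 -> hint phi a a alpha = 0.
Proof.
move=> /andP[a0 a1]; rewrite (@hint_cst R X phi alpha a a 0) ?mul0r//.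
by move=> u /andP[au ua]; move: (le_lt_trans au ua); rewrite ltxx.
Qed.

(** * From dyadic cells to arbitrary intervals *)

Section primitive.
Variable phi : X -> R.
Hypothesis phi_cell : forall k D, controlled (cavg phi k D).
Hypothesis phi1 : forall x, `|phi x| <= 1.

Let step k D : controlled (hint phi 0 (lft R k D)) -> controlled (hint phi 0 (rgt R k D)).
Proof.
move=> h; apply: (@eq_controlled (fun al =>
    hint phi 0 (lft R k D) al + len R k D * cavg phi k D al)).
  by move=> al; rewrite [RHS](@hintU _ _ _ _ _ (lft R k D))
    ?cavgE ?lexx ?cell_ge0 ?cell_le1//; exact/ltW/cell_lt.
by apply: controlledD => //; exact: controlledZ.
Qed.

(** The left end is reached from 0 by adding finitely many cells: the whole copies before the k-th,
    then a left half for every bit [true]. *)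
Let controlled_lft k D : controlled (hint phi 0 (lft R k D)).
Proof.
have hnil : controlled (hint phi 0 (lft R k [::])).
  elim: k => [|k IH].
    apply: eq_controlled (controlled_cst 0) => al.
    by rewrite /= expr0 subrr hint0// lexx ler01.
  by have := step IH; rewrite rgt_nil.
elim: D => [//|[] D IH]; last by rewrite lft_false.
by rewrite -rgt_false; apply: step; rewrite lft_false.
Qed.

Lemma cell_approx (t eps : R) : 0 <= t <= 1 -> 0 < eps ->
  exists k D, lft R k D <= t <= lft R k D + eps.
Proof.
move=> t01 e0.
have small : exists N, (2^-1 ^+ N : R) < eps.
  have [N hN] := @pow_ge R (eps / 2) (ltac:(lra)).
  exists N; have p0 : 0 < (2 ^+ N : R) by rewrite exprn_gt0.
  by rewrite exprVn invf_plt ?posrE// -div1r ltr_pdivrMr//; nra.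
(* The point 1 lies in no copy and is approached by the left ends of whole copies. *)
have [N hN] := small; have [t1|t1] := leP 1 t.
  exists N, [::] => /=; have := pow_half_bounds R N; lra.
have ex : exists k, t < rgt R k [::].
  have [k hk] := @pow_ge R ((1 - t) / 2) (ltac:(lra)).
  exists k; have p0 : 0 < (2 ^+ k : R) by rewrite exprn_gt0.
  have : (2^-1 ^+ k : R) < 1 - t.
    by rewrite exprVn invf_plt ?posrE ?subr_gt0// -div1r ltr_pdivrMr ?subr_gt0//; nra.
  by rewrite rgt_nil exprSr; have := pow_half_bounds R k; lra.
have [k [kt tk]] : exists k, lft R k [::] <= t /\ t < rgt R k [::].
  exists (ex_minn ex); case: ex_minnP => -[|k] tk mi; split => //.
    by rewrite /= expr0 subrr; lra.
  have := contraNN (mi k) (_ : ~~ (k < k)%N); rewrite ltnn -leNgt rgt_nil => h.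
  exact: h.
have [D [sD [D1 D2]]] : exists D, size D = N /\ lft R k D <= t /\ t < rgt R k D.
  elim: N {hN} => [|n [D [sD [D1 D2]]]]; first by exists [::].
  have [h|h] := leP (lft R k (true :: D)) t.
    by exists (true :: D); rewrite /= sD rgt_true.
  by exists (false :: D); rewrite /= sD addr0 rgt_false.
exists k, D; move: D1 D2; rewrite /rgt /len sD => D1 D2.
have : (2^-1 ^+ k.+1 * 2^-1 ^+ N : R) <= 2^-1 ^+ N.
  by rewrite ler_piMl//; have := pow_half_bounds R k.+1; have := pow_half_bounds R N; lra.
lra.
Qed.

Lemma controlled_primitive (t : R) : 0 <= t <= 1 -> controlled (hint phi 0 t).
Proof.
move=> t01; apply: controlled_lim => eps e0.
have [k [D hD]] := cell_approx t01 e0.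
have l0 := cell_ge0 R k D.
exists (hint phi 0 (lft R k D)) => // al.
rewrite (@hintU _ _ _ _ _ (lft R k D) t)//; try lra.
rewrite addrAC subrr add0r.
apply: le_trans (@hint_bound R X phi al (lft R k D) t 1 _ _ _ phi1) _ => //; try lra.
Qed.

End primitive.

Lemma pou_norm n i x : (i <= n)%N -> `|e n i x| <= 1.
Proof.
move=> iN; rewrite ger0_norm ?pou_ge0// -(pou_sum S n x).
have iN' : (i < n.+1)%N by [].
rewrite (bigD1 (Ordinal iN'))//= lerDl.
by apply: sumr_ge0 => j _; exact: pou_ge0.
Qed.

(** Replacing the function by a uniformly close combination of the [pou n i] reduces the claim to
    differences of primitives. *)
Lemma S_HM_controlled psi : S_HM psi -> controlled psi.
Proof.
move=> [phi [a [b [cphi a0 ab b1 ->]]]].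
apply: (@eq_controlled (fun al => (b - a)^-1 * hint phi a b al)) => //.
apply: controlledZ; apply: controlled_lim => eps e0.
have [n [w hw]] := pou_dense S cphi e0.
exists (fun al => \sum_(i < n.+1) w i * hint (e n i) a b al).
  apply: controlled_sum => i _; apply: controlledZ.
  have iN : (i <= n)%N by rewrite -ltnS.
  have cp t : 0 <= t <= 1 -> controlled (hint (e n i) 0 t).
    by apply: controlled_primitive => [k D|x]; [exact: controlled_cavg|exact: pou_norm].
  apply: (@eq_controlled (fun al => hint (e n i) 0 b al - hint (e n i) 0 a al)).
    by move=> al; rewrite (@hintU _ _ _ _ 0 a b)//; lra.
  by apply: controlledB; apply: cp; lra.
move=> al; rewrite -hint_sum//; last exact: ltW.
apply: le_trans (@hint_dist R X phi _ al a b eps _ _ _ hw) _ => //; first exact: ltW.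
by rewrite ler_piMr//; lra.
Qed.

Lemma coords_S_HM (c : address) :
  S_HM (fun alpha => J alpha c) \/ exists v, forall alpha, J alpha c = v.
Proof.
case: c => [[k D] [i|]]; rewrite /coords /=.
  case: (i < size D)%N; last by right; exists 0.
  left; exists (e (size D) i), (lft R k (false :: D)), (rgt R k (false :: D)).
  by split; [exact: pou_cont|exact: cell_ge0|exact: cell_lt|exact: cell_le1|].
case: D => [|b D]; first by right; exists 0.
left; exists (e (size (b :: D)) (size (b :: D))), (lft R k (b :: D)), (rgt R k (b :: D)).
by split; [exact: pou_cont|exact: cell_ge0|exact: cell_lt|exact: cell_le1|].
Qed.

Lemma entourage_S_HM psi (eps : R) : S_HM psi -> 0 < eps ->
  entourage [set fg : HM R X * HM R X | `|psi fg.1 - psi fg.2| < eps].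
Proof.
move=> Spsi e0; exists ([:: psi], eps) => /=.
  by split => // chi; rewrite inE => /eqP ->.
by move=> [f g] /= /(hm_rho_lt _ _ _ e0) h; apply: h; rewrite mem_head.
Qed.

Lemma entourage_coords (c : address) (eps : R) : 0 < eps ->
  entourage [set fg : HM R X * HM R X | `|J fg.1 c - J fg.2 c| < eps].
Proof.
move=> e0; have [h|[v hv]] := coords_S_HM c.
  exact: (@entourage_S_HM (fun alpha => J alpha c)).
apply: filterS (entourageT) => -[f g] _ /=.
by rewrite !hv subrr normr0.
Qed.

Lemma coords_entourage (V : set (HM R X * HM R X)) : entourage V ->
  exists (s : seq address) (del : R), 0 < del /\ forall alpha beta,
    (forall c, c \in s -> `|J alpha c - J beta c| < del) -> V (alpha, beta).
Proof.
move=> [[ps eps] /= [hs e0] hV].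
suff [s [del [d0 h]]] : exists (s : seq address) (del : R), 0 < del /\ forall alpha beta,
    (forall c, c \in s -> `|J alpha c - J beta c| < del) ->
    forall psi, psi \in ps -> `|psi alpha - psi beta| < eps.
  by exists s, del; split => // al be hh; apply: hV => /=; apply/hm_rho_lt => //; exact: h.
elim: ps hs {hV} => [|psi ps IH] hs; first by exists [::], 1.
have [|s1 [d1 [d10 h1]]] := IH; first by move=> chi hc; apply: hs; rewrite inE hc orbT.
have [s2 [d2 [d20 h2]]] := S_HM_controlled (hs psi (mem_head _ _)) e0.
exists (s1 ++ s2), (Num.min d1 d2); split; first by rewrite lt_min d10.
move=> al be h chi; rewrite inE => /orP[/eqP ->|hc].
  by apply: h2 => c cs; have := h c; rewrite mem_cat cs orbT lt_min => /(_ isT) /andP[].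
by apply: h1 => // c cs; have := h c; rewrite mem_cat cs lt_min => /(_ isT) /andP[].
Qed.

End controlled.

(** * Coordinates on the completion *)

Section completion_coordinates.
Variables (R : realType) (X : topologicalType) (S : peaked_system R X).
Local Notation J := (coords S).
Local Notation Y := (HX R X).
Local Arguments coords : simpl never.
Implicit Types (F G : Y) (c : address).

Local Notation cf F := (@cfilter (HM R X) F).

Lemma coord_lim F c : exists v : R, (fun alpha => J alpha c) @ cf F --> v.
Proof.
have PF : ProperFilter (cf F) := cfilter_proper F.
suff h : cvg ((fun alpha => J alpha c) @ cf F).
  by exists (lim ((fun alpha => J alpha c) @ cf F)).
apply/cauchy_cvgP => V [eps /= e0 hV].
have [A FA AV] := cauchy_small PF (@cfilter_cauchy _ F) (entourage_coords S c e0).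
exists ([set J al c | al in A], [set J al c | al in A]) => /=.
  by split; apply: filterS FA => al Aal; exists al.
by move=> [x y] /= [[al Aal <-] [be Abe <-]]; apply: hV; exact: (AV (al, be)).
Qed.

Definition ext F : address -> R := fun c => sval (cid (coord_lim F c)).

Lemma ext_near F c (eps : R) : 0 < eps ->
  cf F [set al | `|ext F c - J al c| < eps].
Proof.
move=> e0; have PF : ProperFilter (cf F) := cfilter_proper F.
by rewrite /ext; case: cid => v /= /cvgrPdist_lt/(_ _ e0).
Qed.

Lemma ext_to_completion alpha : ext (to_completion alpha) = J alpha.
Proof.
apply/funext => c; apply/eqP; rewrite -subr_eq0 -normr_le0 leNgt; apply/negP => h.
set v := `|_| in h.
have h1 := @ext_near (to_completion alpha) c _ (_ : 0 < v / 2).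
have {}h1 := h1 (ltac:(lra)).
have h2 : cf (to_completion alpha) [set be | `|J alpha c - J be c| < v / 2].
  rewrite /=; apply/nbhsP; exists [set fg | `|J fg.1 c - J fg.2 c| < v / 2].
    by apply: entourage_coords; lra.
  by move=> be /xsectionP.
have PF : ProperFilter (cf (to_completion alpha)) := cfilter_proper _.
have [be [g1 g2]] := filter_ex (filterI h1 h2).
have : v < v.
  rewrite /v {1}(_ : ext _ c - J alpha c = (ext (to_completion alpha) c - J be c)
    - (J alpha c - J be c)); last by ring.
  apply: le_lt_trans (ler_normB _ _) _; rewrite [ltRHS](splitr `|_|).
  exact: ltrD.
by rewrite ltxx.
Qed.

Lemma ext_continuous c : continuous (fun F => ext F c).
Proof.
move=> F; apply/(@cvgrPdist_lt _ _ _ (nbhs (F : Y)) (nbhs_filter (F : Y))) => eps e0.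
have e3 : 0 < eps / 3 by lra.
pose V := [set fg : HM R X * HM R X | `|J fg.1 c - J fg.2 c| < eps / 3].
have eV : @entourage Y (completion_close V).
  by exists V => //; exact: entourage_coords.
apply: (@filterS _ _ (nbhs_filter (F : Y)) _ _ _ (nbhs_entourage (F : Y) eV)).
move=> G /xsectionP [A [/= FA GA] AV].
have PF : ProperFilter (cf F) := cfilter_proper F.
have PG : ProperFilter (cf G) := cfilter_proper G.
have [al [Aal hal]] := filter_ex (filterI FA (ext_near F c e3)).
have [be [Abe hbe]] := filter_ex (filterI GA (ext_near G c e3)).
have := AV (al, be) (conj Aal Abe); move: hal hbe; rewrite /V /= !ltr_norml; lra.
Qed.

Lemma ext_entourage (E : set (Y * Y)) : entourage E ->
  exists (s : seq address) (del : R), 0 < del /\ forall F G,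
    (forall c, c \in s -> `|ext F c - ext G c| < del) -> E (F, G).
Proof.
move=> [V eV VE]; have [s [del [d0 h]]] := coords_entourage S eV.
exists s, (del / 3); split; first lra.
move=> F G FG; apply: VE.
(* The same set serves both filters: del/3 + del/6 = del/2 for G, and two points of [A] differ by
   less than del in each coordinate. *)
pose A : set (HM R X) := [set al | forall c, c \in s -> `|ext F c - J al c| < del / 2].
have near_s (H : Y) (P : address -> set (HM R X)) : (forall c, c \in s -> cf H (P c)) ->
    cf H [set al | forall c, c \in s -> P c al].
  have PH : ProperFilter (cf H) := cfilter_proper H.
  elim: (s) => [|c t IH] hP; first by apply: filterS filterT.
  have h1 := hP c (mem_head _ _).
  have h2 : cf H [set al | forall c, c \in t -> P c al].
    by apply: IH => c' hc; apply: hP; rewrite inE hc orbT.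
  apply: filterS (filterI h1 h2) => al [p1 p2] c'; rewrite inE => /orP[/eqP ->//|].
  exact: p2.
exists A.
  split => /=; apply: near_s => c cs; first by apply: ext_near; lra.
  have PG : ProperFilter (cf G) := cfilter_proper G.
  apply: filterS (ext_near G c (_ : 0 < del / 6)); last lra.
  by move=> al /=; have := FG c cs; rewrite !ltr_norml; lra.
move=> [al be] [/= hal hbe]; apply: h => c cs.
by have := hal c cs; have := hbe c cs; rewrite !ltr_norml; lra.
Qed.

Lemma ext_inj : injective ext.
Proof.
move=> F G FG; apply: completion_separated => E /ext_entourage[s [del [d0 h]]].
by apply: h => c _; rewrite FG subrr normr0.
Qed.

Lemma completion_ge0 (g : Y -> R) : continuous g ->
  (forall alpha, 0 <= g (to_completion alpha)) -> forall F, 0 <= g F.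
Proof.
move=> cg hg F; rewrite leNgt; apply/negP => gF.
have oO : open (g @^-1` [set v | v < 0]) by apply: open_comp => // ? _; exact: cg.
have [F0 [gn [al _ e]]] := @to_completion_dense (HM R X) _ (ex_intro _ F gF) oO.
by move: gn; rewrite /= -e ltNge hg.
Qed.

(** The inequalities are closed conditions, by continuity of [lo] and [hi], and hold on the dense
    set of step functions. *)
Lemma ext_tower F : in_tower S (ext F).
Proof.
move=> c; rewrite /in_range.
have cl : continuous (fun F => lo S c (ext F)) by apply: lo_cont; exact: ext_continuous.
have ch : continuous (fun F => hi S c (ext F)) by apply: hi_cont; exact: ext_continuous.
have ce := @ext_continuous c.
apply/andP; split; rewrite -subr_ge0.
- apply: (completion_ge0 (g := fun F => ext F c - lo S c (ext F))).
    exact: continuousB2.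
  by move=> al; rewrite ext_to_completion subr_ge0; have /andP[] := coords_tower S al c.
- apply: (completion_ge0 (g := fun F => hi S c (ext F) - ext F c)).
    exact: continuousB2.
  by move=> al; rewrite ext_to_completion subr_ge0; have /andP[] := coords_tower S al c.
Qed.

Lemma ext_01 F c : 0 <= ext F c <= 1.
Proof.
have [h1 h2] := @wid_bounds _ _ S c (ext F) (fun c' _ => ext_tower F c').
by have := ext_tower F c; rewrite /in_range; lra.
Qed.

(** Exact realisation makes the sets that prescribe finitely many coordinates nonempty; they
    generate a Cauchy filter, whose limit has all the coordinates of x. *)
Lemma ext_surj x : in_tower S x -> exists F, ext F = x.
Proof.
move=> Tx.
pose B (s : seq address) : set Y := [set F | forall c, c \in s -> ext F c = x c].
pose Phi : set_system Y := filter_from setT B.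
have FPhi : Filter Phi.
  apply: filter_from_filter; first by exists [::].
  move=> s t _ _; exists (s ++ t) => // F h; split=> c cs; apply: h;
    by rewrite mem_cat cs ?orbT.
have PPhi : ProperFilter Phi.
  apply: filter_from_proper => s _.
  have [al hal] := coords_dense Tx s; exists (to_completion al) => c cs.
  by rewrite ext_to_completion hal.
have cPhi : cauchy Phi.
  move=> E /ext_entourage[s [del [d0 h]]].
  exists (B s, B s); first by split; exists s.
  by move=> [F G] [/= hF hG]; apply: h => c cs; rewrite hF// hG// subrr normr0.
have [F PhiF] := completion_complete PPhi cPhi.
exists F; apply/funext => c.
have h1 : (fun G => ext G c) @ Phi --> ext F c.
  by apply: cvg_trans (@ext_continuous c F); exact: cvg_app.
have h2 : (fun G => ext G c) @ Phi --> x c.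
  apply: (@cvg_near_cst _ _ _ _ _ FPhi).
  by exists [:: c] => // G hG; apply/hG/mem_head.
exact: (cvg_unique _ h1 h2).
Qed.

(** Along an ultrafilter every coordinate converges, being in [0, 1]; the coordinates control the
    entourages, so the ultrafilter is Cauchy, and completeness applies. *)
Lemma completion_compact : compact [set: Y].
Proof.
rewrite compact_ultra => U UU _.
have PU : ProperFilter U by exact: ultra_proper.
have lims c : exists v : R, forall eps, 0 < eps -> U [set F | `|v - ext F c| < eps].
  have in01 : U [set F | `[0, 1]%classic (ext F c)].
    by apply: filterE => F /=; rewrite in_itv /=; exact: ext_01.
  have [v [_ clv]] := @segment_compact R 0 1 ((fun F => ext F c) @ U) _ in01.
  exists v => eps e0.
  have [//|h] := in_ultra_setVsetC [set F | `|v - ext F c| < eps] UU.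
  have [w [/= hw vw]] := clv [set w | ~ `|v - w| < eps] [set w | `|v - w| < eps] h
    (nbhsx_ballx v eps e0).
  by [].
have cU : cauchy U.
  move=> E /ext_entourage[s [del [d0 h]]].
  have near_s (t : seq address) : exists A : set Y, U A /\
      forall F G, A F -> A G -> forall c, c \in t -> `|ext F c - ext G c| < del.
    elim: t => [|c t [A [UA hA]]]; first by exists setT; split; [exact: filterT|].
    have [v hv] := lims c; have {}hv := hv (del / 2) (ltac:(lra)).
    exists (A `&` [set F | `|v - ext F c| < del / 2]); split; first exact: filterI.
    move=> F G [AF vF] [AG vG] c'; rewrite inE => /orP[/eqP ->|]; last exact: hA.
    by move: vF vG; rewrite /= !ltr_norml; lra.
  have [A [UA hA]] := near_s s.
  exists (A, A); first by split.
  by move=> [F G] [/= AF AG]; apply: h; exact: hA.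
have [F UF] := completion_complete PU cU.
by exists F.
Qed.

End completion_coordinates.

(** * Homeomorphism with the cube *)

Lemma continuous_prod (Z : topologicalType) (I : Type) (T : I -> topologicalType)
    (f : Z -> prod_topology T) :
  (forall i, continuous (fun z => f z i)) -> continuous f.
Proof.
move=> cf z; apply/cvg_sup => i.
exact: (@continuous_comp_initial _ _ _ (fun g : forall i, T i => g i) f (cf i) z).
Qed.

Lemma hausdorff_of_injective_family (R : realType) (T : topologicalType) (I : Type)
    (f : I -> T -> R) : (forall i, continuous (f i)) ->
  (forall x y, (forall i, f i x = f i y) -> x = y) -> hausdorff_space T.
Proof.
move=> cf inj x y cxy; apply: inj => i; apply: Rhausdorff => A B nA nB.
have [z [Az Bz]] := cxy _ _ (cf i x _ nA) (cf i y _ nB).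
by exists (f i z).
Qed.

Lemma compact_bijection_homeomorphic (T U : topologicalType) (f : T -> U) (g : U -> T) :
  compact [set: T] -> hausdorff_space U -> cancel f g -> cancel g f ->
  continuous f -> homeomorphic T U.
Proof.
move=> cT hU fK gK cf; exists f, g; split => //.
apply/continuous_closedP => A cA.
have -> : g @^-1` A = f @` A.
  by apply/seteqP; split=> [u Au|_ [t At <-]] /=; [exists (g u)|rewrite fK].
apply: compact_closed => //; apply: continuous_compact.
  by apply: continuous_subspaceT.
exact: (subclosed_compact cA cT).
Qed.

Lemma hilbert_cube_hausdorff (R : realType) (l u : nat -> R) :
  hausdorff_space (hilbert_cube l u).
Proof.
apply: (@hausdorff_of_injective_family R _ nat
  (fun n (q : hilbert_cube l u) => set_val (q n))) => [n q|p q pq].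
  have c1 : continuous (fun p : hilbert_cube l u => p n).
    exact: (@proj_continuous nat (fun n => `[l n, u n]%classic : topologicalType) n).
  apply: continuous_comp; first exact: c1.
  exact: initial_continuous.
by apply: functional_extensionality_dep => n; apply: val_inj; exact: pq.
Qed.

Theorem theorem1p1 (R : realType) (X : topologicalType) (l u : nat -> R)
  (cptX : compact [set: X]) (metX : metrizable R X)
  (X2 : exists x y : X, x <> y) (lu : forall n, l n < u n) :
  homeomorphic (HX R X) (hilbert_cube l u).
Proof.
have [S] := peaked_system_exists cptX metX X2.
have [H [cH Hb Hinj Hsurj]] := coordinates_cube S.
have w0 n : 0 < u n - l n by rewrite subr_gt0.
(* The affine map of [-1, 1] onto [l n, u n]. *)
pose pos F n := l n + (u n - l n) * ((H (ext S F) n + 1) / 2).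
have pos_in F n : `[l n, u n]%classic (pos F n).
  have := Hb _ (ext_tower S F) n; rewrite /= in_itv /= /pos ler_norml => h.
  by have := w0 n; nra.
pose Psi F : hilbert_cube l u := fun n => SigSub (mem_set (pos_in F n)).
have PsiE F n : set_val (Psi F n) = pos F n by [].
have Psi_inj F G : Psi F = Psi G -> F = G.
  move=> FG; apply: (@ext_inj _ _ S); apply: Hinj; [exact: ext_tower..|].
  apply/funext => n; have : pos F n = pos G n by rewrite -!PsiE FG.
  move=> /addrI /(mulfI (lt0r_neq0 (w0 n))); lra.
have Psi_surj q : exists F, Psi F = q.
  pose v n := 2 * ((set_val (q n) - l n) / (u n - l n)) - 1.
  have v1 n : `|v n| <= 1.
    have : `[l n, u n]%classic (set_val (q n)) by exact: set_valP.
    rewrite /= in_itv /= => h.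
    have : 0 <= (set_val (q n) - l n) / (u n - l n) <= 1.
      by rewrite divr_ge0 ?ler_pdivrMr//; lra.
    by rewrite /v ler_norml; lra.
  have [x Tx Hx] := Hsurj v v1; have [F Fx] := ext_surj Tx.
  exists F; apply: functional_extensionality_dep => n; apply: val_inj.
  rewrite -[RHS]/(set_val (q n)) [LHS]PsiE /pos Fx Hx /v.
  by have /lt0r_neq0 h := w0 n; field.
have [g Psig] := choice Psi_surj.
apply: (@compact_bijection_homeomorphic _ _ Psi g).
- exact: completion_compact S.
- exact: hilbert_cube_hausdorff.
- by move=> F; apply: Psi_inj; rewrite Psig.
- exact: Psig.
apply: continuous_prod => n.
apply: (@continuous_comp_initial _ _ _ set_val) => /=.
have cpos : continuous (fun F => pos F n).
  apply: continuousD2; first exact: continuous_cst2.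
  apply: continuousM2; first exact: continuous_cst2.
  apply: continuousM2; last exact: continuous_cst2.
  apply: continuousD2; last exact: continuous_cst2.
  by apply: cH => c; exact: ext_continuous.
exact: cpos.
Qed.
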